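(* There is an arithmetic term $W(n,k)$ with the following property. If $n$ is the code of a statement $T\vdash \varphi$ and there is a proof of $\varphi$ in $T$ whose code has length $\le k$, then $W(n,k) = \pi$ for such a proof code $\pi$ (a code of a proof of $\varphi$ in $T$ of length $\le k$). In all other situations, $W(n,k) = 0$.
   Context: $\mathbb{N}=\{0,1,2,\dots\}$. An arithmetic term is a finite expression built from variables ranging over $\mathbb{N}$ and natural-number constants by composing addition $x+y$, truncated subtraction $x \dot{-} y=\max(x-y,0)$, multiplication, $\lfloor x/y\rfloor$, $x \bmod y$, and exponentiation $x^y$ (conventions: $x \bmod 0 = x$; for definiteness $\lfloor x/0\rfloor=0$, $0^0=1$). Fix once and for all an encoding of first-order formulas, axiom schemes and proofs as words over a finite alphabet (including the symbols $;$ and $\vdash$), and of words as natural numbers. Statements $T\vdash\varphi$, where $T$ is a finite list of axioms and axiom schemes separated by $;$ and $\varphi$ is a sentence, and fully formalized proofs in $T$ (e.g. numbered lines with derivation hints, separated by $;$) are both represented by natural numbers; codes of proofs are nonzero. The length of a proof code is the number of characters of the proof. Verifying that a given word is a valid proof of $\varphi$ in $T$ is possible in deterministic polynomial time. *)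

(* Defs.v *)
From mathcomp Require Import all_boot.

Set Implicit Arguments.
Unset Strict Implicit.
Unset Printing Implicit Defensive.

(** MathComp's conventions on [nat] are the intended ones: [x - y] is truncated,
    [x %/ 0 = 0], [x %% 0 = x] and [0 ^ 0 = 1]. *)

Inductive aterm (m : nat) : Type :=
| AVar of 'I_m
| AConst of nat
| AAdd of aterm m & aterm m
| ASub of aterm m & aterm m
| AMul of aterm m & aterm m
| ADiv of aterm m & aterm m
| AMod of aterm m & aterm m
| AExp of aterm m & aterm m.

Fixpoint aeval (m : nat) (v : m.-tuple nat) (t : aterm m) : nat :=
  match t with
  | AVar i => tnth v i
  | AConst c => c
  | AAdd a b => aeval v a + aeval v b
  | ASub a b => aeval v a - aeval v b
  | AMul a b => aeval v a * aeval v b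
  | ADiv a b => aeval v a %/ aeval v b
  | AMod a b => aeval v a %% aeval v b
  | AExp a b => aeval v a ^ aeval v b
  end.

(** Variables are de Bruijn indices.  A function, relation or schematic symbol
    is identified by its index together with the number of its arguments, so
    there are countably many symbols of each arity.  The remaining connectives
    and the existential quantifier are the usual classical abbreviations. *)

Inductive term : Type :=
| Var of nat
| Fn of nat & seq term.

(** [Meta i ts] is a schematic predicate letter applied to terms.  A formula in
    which [Meta] occurs is an axiom scheme; the formulas of first-order logic
    proper are the [meta_free] ones. *)
Inductive formula : Type :=
| Bot
| Eq of term & term
| Rel of nat & seq term
| Meta of nat & seq term
| Imp of formula & formula
| All of formula.

Fixpoint meta_free (f : formula) : bool :=
  match f with
  | Bot | Eq _ _ | Rel _ _ => true
  | Meta _ _ => false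
  | Imp f g => meta_free f && meta_free g
  | All f => meta_free f
  end.

Fixpoint term_below (d : nat) (t : term) : bool :=
  match t with
  | Var n => n < d
  | Fn _ ts => all (term_below d) ts
  end.

Fixpoint formula_below (d : nat) (f : formula) : bool :=
  match f with
  | Bot => true
  | Eq t u => term_below d t && term_below d u
  | Rel _ ts | Meta _ ts => all (term_below d) ts
  | Imp f g => formula_below d f && formula_below d g
  | All f => formula_below d.+1 f
  end.

Definition formula_closed (f : formula) : bool := formula_below 0 f.

Definition sentence (f : formula) : bool := formula_closed f && meta_free f.

Fixpoint term_subst (s : nat -> term) (t : term) : term :=
  match t with
  | Var n => s n
  | Fn i ts => Fn i (map (term_subst s) ts)
  end.

Definition term_shift : term -> term := term_subst (fun n => Var n.+1).

Definition up (s : nat -> term) (n : nat) : term :=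
  if n is n'.+1 then term_shift (s n') else Var 0.

Fixpoint subst (s : nat -> term) (f : formula) : formula :=
  match f with
  | Bot => Bot
  | Eq t u => Eq (term_subst s t) (term_subst s u)
  | Rel i ts => Rel i (map (term_subst s) ts)
  | Meta i ts => Meta i (map (term_subst s) ts)
  | Imp f g => Imp (subst s f) (subst s g)
  | All f => All (subst (up s) f)
  end.

Definition shift : formula -> formula := subst (fun n => Var n.+1).

(** [subst1 t f] instantiates the variable bound by the quantifier of [All f]. *)
Definition subst1 (t : term) : formula -> formula :=
  subst (fun n => if n is n'.+1 then Var n' else t).

(** An instantiation maps schematic letters, given as (index, arity), to
    formulas; letters not listed are sent to [Bot]. *)
Definition instantiation := seq ((nat * nat) * formula).

Definition lookup (s : instantiation) (i k : nat) : formula :=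
  nth Bot (unzip2 s) (index (i, k) (unzip1 s)).

(** In the formula substituted for a letter of arity [k], the variables
    [0, ..., k-1] stand for the arguments and the variables [k, k+1, ...] are
    parameters; [d] is the number of quantifiers crossed, so that parameters are
    never captured. *)
Fixpoint instantiate (s : instantiation) (d : nat) (f : formula) : formula :=
  match f with
  | Bot | Eq _ _ | Rel _ _ => f
  | Meta i ts =>
      subst (fun n => if n < size ts then nth (Var 0) ts n
                      else Var (d + (n - size ts)))
            (lookup s i (size ts))
  | Imp f g => Imp (instantiate s d f) (instantiate s d g)
  | All f => All (instantiate s d.+1 f)
  end.

(** Together with modus ponens and generalization (see [justified]), these are
    complete for classical first-order logic with equality. *)
Inductive logical_axiom : formula -> Prop :=
| LogK f g : logical_axiom (Imp f (Imp g f))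
| LogS f g h :
    logical_axiom (Imp (Imp f (Imp g h)) (Imp (Imp f g) (Imp f h)))
| LogDN f : logical_axiom (Imp (Imp (Imp f Bot) Bot) f)
| LogInst t f : logical_axiom (Imp (All f) (subst1 t f))
| LogDist f g : logical_axiom (Imp (All (Imp f g)) (Imp (All f) (All g)))
| LogVac f : logical_axiom (Imp f (All (shift f)))
| LogRefl t : logical_axiom (Eq t t)
| LogLeibniz t u f :
    logical_axiom (Imp (Eq t u) (Imp (subst1 t f) (subst1 u f))).

Inductive hint : Type :=
| ByLogic
| ByAxiom of nat & instantiation
| ByMP of nat & nat
| ByGen of nat.

(** A proof is a sequence of lines, numbered from 0; each line carries a formula
    and a hint.  Line numbers in hints refer to earlier lines. *)
Definition line : Type := formula * hint.

(** Free variables of a line are read as universally quantified; in particular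
    an instance of a scheme with parameters amounts to its universal closure. *)
Definition justified (T : seq formula) (prev : seq formula) (f : formula)
    (h : hint) : Prop :=
  match h with
  | ByLogic => logical_axiom f
  | ByAxiom i s =>
      [/\ i < size T, all meta_free (unzip2 s) & f = instantiate s 0 (nth Bot T i)]
  | ByMP i j =>
      [/\ i < size prev, j < size prev
        & nth Bot prev i = Imp (nth Bot prev j) f]
  | ByGen i => i < size prev /\ f = All (nth Bot prev i)
  end.

Definition is_proof (T : seq formula) (phi : formula) (P : seq line) : Prop :=
  (forall (P1 P2 : seq line) (f : formula) (h : hint),
      P = P1 ++ (f, h) :: P2 -> meta_free f /\ justified T (unzip1 P1) f h)
  /\ (exists (P1 : seq line) (h : hint), P = rcons P1 (phi, h)).

(** [T |- phi] is a well-formed statement, provable or not. *)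
Definition is_statement (T : seq formula) (phi : formula) : bool :=
  all formula_closed T && sentence phi.

(** Letters are read as the digits [1, ..., #|A|] in base [#|A|.+1], most
    significant first.  No digit is [0], so distinct words have distinct codes
    and only the empty word has code [0]. *)
Definition word_code (A : finType) (w : seq A) : nat :=
  foldl (fun c x => c * #|A|.+1 + (enum_rank x).+1) 0 w.

Fixpoint join (A : Type) (sep : A) (ws : seq (seq A)) : seq A :=
  match ws with
  | [::] => [::]
  | [:: w] => w
  | w :: ws' => w ++ sep :: join sep ws'
  end.

(** An encoding of formulas (hence of axioms and schemes) and of numbered proof
    lines as words.  The separators do not occur inside the encoded items, so
    statements and proofs can be read back from their words. *)
Record encoding : Type := Encoding {
  letter : finType;
  semicolon : letter;
  turnstile : letter;
  enc_formula : formula -> seq letter;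
  enc_line : nat -> line -> seq letter;
  semicolon_turnstile : semicolon != turnstile;
  enc_formula_inj : injective enc_formula;
  enc_formula_nonempty : forall f, enc_formula f != [::];
  enc_formula_semicolon : forall f, semicolon \notin enc_formula f;
  enc_formula_turnstile : forall f, turnstile \notin enc_formula f;
  enc_line_inj : forall i, injective (enc_line i);
  enc_line_nonempty : forall i l, enc_line i l != [::];
  enc_line_semicolon : forall i l, semicolon \notin enc_line i l
}.

Definition statement_word (E : encoding) (T : seq formula) (phi : formula) :
    seq (letter E) :=
  join (semicolon E) (map (enc_formula E) T) ++ turnstile E :: enc_formula E phi.

Definition proof_word (E : encoding) (P : seq line) : seq (letter E) :=
  join (semicolon E) [seq enc_line E p.1 p.2 | p <- zip (iota 0 (size P)) P].

Definition is_statement_code (E : encoding) (T : seq formula) (phi : formula)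
    (n : nat) : Prop :=
  is_statement T phi /\ n = word_code (statement_word E T phi).

Definition is_proof_code_le (E : encoding) (T : seq formula) (phi : formula)
    (k p : nat) : Prop :=
  exists P : seq line,
    [/\ is_proof T phi P, size (proof_word E P) <= k
      & p = word_code (proof_word E P)].

Inductive move : Type := MoveLeft | Stay | MoveRight.

(** A deterministic one-tape machine with input alphabet [I].  Tape symbols are
    the input letters, auxiliary letters, and the blank [None].  The machine
    halts with answer [b] on reaching a state [q] with [tm_halt q = Some b]. *)
Record tm (I : finType) : Type := TM {
  tm_state : finType;
  tm_aux : finType;
  tm_start : tm_state;
  tm_halt : tm_state -> option bool;
  tm_delta : tm_state -> option (I + tm_aux) ->
             tm_state * option (I + tm_aux) * move
}.

(** State, tape to the left of the head (nearest cell first), tape from the head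
    rightwards; all cells not listed are blank. *)
Definition tm_config (I : finType) (M : tm I) : Type :=
  tm_state M * seq (option (I + tm_aux M)) * seq (option (I + tm_aux M)).

Definition tm_init (I : finType) (M : tm I) (w : seq I) : tm_config M :=
  (tm_start M, [::], [seq Some (inl x) | x <- w]).

Definition tm_step (I : finType) (M : tm I) (c : tm_config M) : tm_config M :=
  let: (q, l, r) := c in
  if tm_halt q is Some _ then c else
  let: (q', a, m) := tm_delta q (head None r) in
  match m with
  | MoveLeft => (q', behead l, head None l :: a :: behead r)
  | Stay => (q', l, a :: behead r)
  | MoveRight => (q', a :: l, behead r)
  end.

Definition tm_answers (I : finType) (M : tm I) (w : seq I) (t : nat) (b : bool) :
    Prop :=
  tm_halt (iter t (@tm_step I M) (tm_init M w)).1.1 = Some b.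

(** The two words are presented to the machine separated by the extra input
    letter [None]. *)
Definition pair_word (A : finType) (u v : seq A) : seq (option A) :=
  map Some u ++ None :: map Some v.

Definition poly_time_decidable2 (A : finType) (R : seq A -> seq A -> Prop) :
    Prop :=
  exists (M : tm (option A)) (c d : nat), forall u v : seq A,
    exists (t : nat) (b : bool),
      [/\ t <= c * size (pair_word u v) ^ d + c,
          tm_answers M (pair_word u v) t b & b <-> R u v].

Definition poly_time_verifiable (E : encoding) : Prop :=
  poly_time_decidable2 (fun u v : seq (letter E) =>
    exists (T : seq formula) (phi : formula) (P : seq line),
      [/\ is_statement T phi, u = statement_word E T phi,
          v = proof_word E P & is_proof T phi P]).

(* Main.v *)
Require Import Defs.
From mathcomp Require Import all_boot.
From mathcomp Require Import zify.

Set Implicit Arguments.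
Unset Strict Implicit.
Unset Printing Implicit Defensive.

(** Vectors of numbers are packed as the digits of one number in a large base
    [2 ^ w].  Geometric sums, greatest common divisors, central binomial
    coefficients and hence (Kummer) binary digit sums are arithmetic terms; digit
    sums of packed vectors count the solutions of exponential inequalities in a
    box, which yields a term for spreading the binary digits of [x] in base [y],
    and then one for bitwise conjunction.  With bitwise conjunction, a function
    built from addition, truncated subtraction, conjunction and shifts is computed
    on all components of a packed vector at once, by a function of the same kind.
    Doing this over time checks a guessed run of a transition system; doing it
    again over all guesses finds the least valid guess.  The transition system
    first writes, letter by letter, a proof and a statement whose codes it
    accumulates, and then simulates the Turing machine that verifies proofs. *)

(** A term has a fixed size and no recursion, so nothing can be computed step by step: every
    intermediate object must have a closed form, and the sums available at the start are geometric
    ones. Exponentiation makes up for this: astronomically large numbers cost nothing, so all times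
    of a run, and all candidate runs, can lie side by side in one integer. What limits the method is
    that the product of two packed vectors is not the packed vector of the products. Componentwise
    operations must avoid products of variables (scaling by a parameter is harmless), and this is
    why conjunction matters: it masks components, which yields componentwise truncated subtraction
    and shifts. It is also why the machine is described by affine equations between consecutive
    values, with guessed quotients in place of divisions. Since the lifted function lies in the same
    class, lifting can be iterated. The polynomial time bound serves to express the length of a run,
    and with it the size of all its numbers, by a term in [n] and [k]. *)

Definition rep m (f : m.-tuple nat -> nat) : Prop :=
  exists t : aterm m, forall v, aeval v t = f v.

Create HintDb rep.

Section Rep.
Variable m : nat.
Implicit Types f g h : m.-tuple nat -> nat.

Lemma rep_ext f g : (forall v, f v = g v) -> rep f -> rep g.
Proof. by move=> fg [t tf]; exists t => v; rewrite tf. Qed.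

Lemma rep_const c : @rep m (fun=> c).
Proof. by exists (AConst m c). Qed.

Lemma rep_var (i : 'I_m) : rep (fun v => tnth v i).
Proof. by exists (AVar i). Qed.

Lemma rep_add f g : rep f -> rep g -> rep (fun v => f v + g v).
Proof. by move=> [s sf] [t tg]; exists (AAdd s t) => v /=; rewrite sf tg. Qed.

Lemma rep_sub f g : rep f -> rep g -> rep (fun v => f v - g v).
Proof. by move=> [s sf] [t tg]; exists (ASub s t) => v /=; rewrite sf tg. Qed.

Lemma rep_mul f g : rep f -> rep g -> rep (fun v => f v * g v).
Proof. by move=> [s sf] [t tg]; exists (AMul s t) => v /=; rewrite sf tg. Qed.

Lemma rep_div f g : rep f -> rep g -> rep (fun v => f v %/ g v).
Proof. by move=> [s sf] [t tg]; exists (ADiv s t) => v /=; rewrite sf tg. Qed.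

Lemma rep_mod f g : rep f -> rep g -> rep (fun v => f v %% g v).
Proof. by move=> [s sf] [t tg]; exists (AMod s t) => v /=; rewrite sf tg. Qed.

Lemma rep_exp f g : rep f -> rep g -> rep (fun v => f v ^ g v).
Proof. by move=> [s sf] [t tg]; exists (AExp s t) => v /=; rewrite sf tg. Qed.

Lemma rep_succ f : rep f -> rep (fun v => (f v).+1).
Proof.
by move=> rf; apply: rep_ext (rep_add rf (rep_const 1)) => v; rewrite addn1.
Qed.

End Rep.

#[export] Hint Resolve rep_const rep_var rep_add rep_sub rep_mul rep_div rep_mod
  rep_exp rep_succ : rep.

(** * Packed vectors *)

Definition pack (q n : nat) (c : nat -> nat) : nat := \sum_(i < n) c i * q ^ i.

Lemma eq_pack q n c d : (forall i, i < n -> c i = d i) -> pack q n c = pack q n d.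
Proof. by move=> cd; apply: eq_bigr => i _; rewrite cd. Qed.

Lemma packS q n c : pack q n.+1 c = c 0 + q * pack q n (fun i => c i.+1).
Proof.
rewrite /pack big_ord_recl muln1; congr addn; rewrite big_distrr.
by apply: eq_bigr => i _; rewrite /= expnS mulnCA.
Qed.

Lemma packSr q n c : pack q n.+1 c = pack q n c + c n * q ^ n.
Proof. by rewrite /pack big_ord_recr. Qed.

Lemma packD q n c d : pack q n (fun i => c i + d i) = pack q n c + pack q n d.
Proof. by rewrite /pack -big_split; apply: eq_bigr => i _; rewrite mulnDl. Qed.

Lemma packMl q n a c : pack q n (fun i => a * c i) = a * pack q n c.
Proof. by rewrite /pack big_distrr; apply: eq_bigr => i _; rewrite /= mulnA. Qed.

Lemma packMr q n a c : pack q n (fun i => c i * a) = pack q n c * a.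
Proof. by rewrite mulnC -packMl; apply: eq_pack => i _; rewrite mulnC. Qed.

Lemma leq_pack q n c d :
  (forall i, i < n -> c i <= d i) -> pack q n c <= pack q n d.
Proof. by move=> cd; apply: leq_sum => i _; rewrite leq_mul ?cd. Qed.

Lemma packB q n c d : (forall i, i < n -> d i <= c i) ->
  pack q n (fun i => c i - d i) = pack q n c - pack q n d.
Proof.
move=> dc; apply/eqP; rewrite eq_sym -(eqn_add2r (pack q n d)) subnK ?leq_pack //.
by rewrite -packD; apply/eqP/eq_pack => i lt_in; rewrite subnK ?dc.
Qed.

Lemma pack_lt q n c : (forall i, i < n -> c i < q) -> pack q n c < q ^ n.
Proof.
elim: n => [|n IH] cq; first by rewrite /pack big_ord0.
rewrite packSr expnS; have := IH (fun i lt_in => cq i (ltnW lt_in)).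
by have := cq n (ltnSn n); nia.
Qed.

Lemma pack_digit q n c j : (forall i, i < n -> c i < q) -> j < n ->
  pack q n c %/ q ^ j %% q = c j.
Proof.
elim: n c j => // n IH c [|j] cq lt_jn; rewrite packS.
  by rewrite divn1 addnC mulnC modnMDl modn_small ?cq.
have c0 := cq 0 (ltn0Sn n); have q0 := leq_ltn_trans (leq0n _) c0.
rewrite expnS divnMA addnC mulnC divnMDl // [c 0 %/ q]divn_small // addn0.
by rewrite (IH (fun i => c i.+1)) // => i lt_in; apply: (cq i.+1).
Qed.

Lemma pack_digits q n x : x < q ^ n -> pack q n (fun i => x %/ q ^ i %% q) = x.
Proof.
elim: n x => [|n IH] x; first by rewrite /pack big_ord0; lia.
move=> lt_x; rewrite packS divn1.
under eq_pack do rewrite expnS divnMA.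
have q0 : 0 < q by move: lt_x; case: (q) => // ; rewrite exp0n.
rewrite IH; first by rewrite [RHS](divn_eq x q) addnC mulnC.
by rewrite ltn_divLR // -expnSr.
Qed.

Lemma pack1 q n : (q - 1) * pack q n (fun=> 1) + 1 = q ^ n \/ q = 0.
Proof.
case: q => [|q]; [by right | left].
elim: n => [|n IH]; first by rewrite /pack big_ord0 muln0.
by rewrite packSr expnS -IH; nia.
Qed.

Lemma pack1E q n : 1 < q -> pack q n (fun=> 1) = (q ^ n - 1) %/ (q - 1).
Proof.
move=> q1; case: (pack1 q n) => [<-|q0]; last by rewrite q0 in q1.
by rewrite addnK mulKn // subn_gt0.
Qed.

(** Summation by parts: [q - 1] times the sum of [i * q ^ i] is [n * q ^ n] minus the sum of [q ^ i]
    for [1 <= i <= n]; the [+ 1] offsets the term [i = 0] of the full geometric sum. *)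
Lemma packidE q n : 1 < q ->
  pack q n id = (n * q ^ n + 1 - pack q n.+1 (fun=> 1)) %/ (q - 1).
Proof.
move=> q1; suff -> : n * q ^ n + 1 - pack q n.+1 (fun=> 1) = (q - 1) * pack q n id.
  by rewrite mulKn // subn_gt0.
suff : (q - 1) * pack q n id + pack q n.+1 (fun=> 1) = n * q ^ n + 1.
  by move=> <-; rewrite addnK.
elim: n => [|n IH]; first by rewrite packSr /pack !big_ord0 muln0.
rewrite packSr [pack q n.+2 _]packSr /= expnS.
case: q q1 IH => // q _; rewrite subn1 /=; set P := pack _ n id.
by set P1 := pack _ _ _; move: (q.+1 ^ n) => e; nia.
Qed.

Lemma rep_pack1 m (f g : m.-tuple nat -> nat) : (forall v, 1 < f v) ->
  rep f -> rep g -> rep (fun v => pack (f v) (g v) (fun=> 1)).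
Proof.
move=> f1 rf rg; apply: (@rep_ext _ (fun v => (f v ^ g v - 1) %/ (f v - 1))).
  by move=> v; rewrite pack1E.
by auto 20 with rep.
Qed.

Lemma rep_packid m (f g : m.-tuple nat -> nat) : (forall v, 1 < f v) ->
  rep f -> rep g -> rep (fun v => pack (f v) (g v) id).
Proof.
move=> f1 rf rg; apply: rep_ext (fun v => esym (packidE (g v) (f1 v))) _.
by have := rep_pack1 f1 rf (rep_succ rg); auto 20 with rep.
Qed.

(** * Exponents modulo [k], greatest common divisors and logarithms *)

Lemma expn_mod_pred q k e : 0 < q -> q ^ e = q ^ (e %% k) %[mod q ^ k - 1].
Proof.
move=> q0; rewrite {1}(divn_eq e k) expnD [_ %/ k * k]mulnC expnM -modnMml -modnXm.
have {1}-> : q ^ k = 1 + (q ^ k - 1) by rewrite subnKC // expn_gt0 q0.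
by rewrite modnDr modnXm exp1n modnMml mul1n.
Qed.

(* Modulo [z ^ k - 1] exponents are reduced modulo [k], which isolates in the
   lowest base-[z] digit the coefficients whose exponent is a multiple of [k]. *)
Lemma sum_mod_pred (I : finType) (c e : I -> nat) z k : 0 < k ->
  (\sum_i c i).+1 < z ->
  (\sum_i c i * z ^ e i) %% (z ^ k - 1) %% z = \sum_(i | k %| e i) c i.
Proof.
move=> k0 cz; have z0 : 0 < z by apply: leq_trans cz.
have -> : (\sum_i c i * z ^ e i) %% (z ^ k - 1)
        = (\sum_i c i * z ^ (e i %% k)) %% (z ^ k - 1).
  elim/big_rec2: _ => // i x y _ xy; rewrite -modnDm xy modnDm.
  by rewrite -modnDml -modnMmr (expn_mod_pred _ _ z0) modnMmr modnDml.
rewrite [in X in X %% z]modn_small.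
  rewrite (bigID (fun i => k %| e i)) /= -modnDmr.
  have -> : (\sum_(i | ~~ (k %| e i)) c i * z ^ (e i %% k)) %% z = 0.
    apply/eqP; apply: dvdn_sum => i ei.
    by rewrite dvdn_mull // dvdn_exp // lt0n.
  rewrite addn0 modn_small.
    by apply: eq_bigr => i /eqP ->; rewrite muln1.
  under eq_bigr => i /eqP -> do rewrite muln1.
  apply: leq_ltn_trans (ltnW cz); rewrite [leqRHS](bigID (fun i => k %| e i)) /=.
  exact: leq_addr.
apply: (@leq_ltn_trans ((\sum_i c i) * z ^ k.-1)).
  rewrite big_distrl; apply: leq_sum => i _; rewrite leq_mul2l leq_pexp2l ?orbT //.
  by have := ltn_pmod (e i) k0; lia.
have: 0 < z ^ k.-1 by rewrite expn_gt0 z0.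
by have -> : z ^ k = z * z ^ k.-1; [rewrite -expnS prednK | nia].
Qed.

(** Division by [g = gcdn a b] turns [b %| a * i] into [b' %| i], because [a'] and [b'] are coprime,
    and [g] of the indices below [b] satisfy this. As a count, the gcd becomes a filtered geometric
    sum. *)
Lemma count_dvd_mul a b : 0 < b -> \sum_(i < b | b %| a * i) 1 = gcdn a b.
Proof.
move=> b0; have g0 : 0 < gcdn a b by rewrite gcdn_gt0 b0 orbT.
have [Da Db] := (dvdn_gcdl a b, dvdn_gcdr a b).
set g := gcdn a b in g0 Da Db *; set b' := b %/ g; set a' := a %/ g.
have eb : b = b' * g by rewrite divnK.
have ea : a = a' * g by rewrite divnK.
have b'0 : 0 < b' by move: b0; rewrite eb muln_gt0 => /andP[].
have cop : coprime b' a'.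
  by rewrite coprime_sym /coprime -(eqn_pmul2r g0) muln_gcdl -ea -eb mul1n.
have dvdE i : (b %| a * i) = (b' %| i).
  by rewrite ea eb -mulnA [g * i]mulnC mulnA dvdn_pmul2r // Gauss_dvdr.
have -> : g = b %/ b' by rewrite [in RHS]eb mulKn.
rewrite divn_count_dvd big_mkcond (eq_bigr (fun i : 'I_b => (b' %| i : nat))).
  rewrite -(big_mkord xpredT (fun i => (b' %| i : nat))).
  have D: b' %| b by rewrite eb dvdn_mulr.
  by rewrite [LHS]big_ltn // [RHS]big_nat_recr // dvdn0 D /= addnC.
by move=> i _; rewrite dvdE; case: (b' %| i).
Qed.

Lemma rep_gcd m (f g : m.-tuple nat -> nat) : (forall v, 0 < g v) ->
  rep f -> rep g -> rep (fun v => gcdn (f v) (g v)).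
Proof.
move=> g0 rf rg; pose z v := (g v).+2.
(* The exponent [(f + g) * i] is divisible by [g] exactly when [f * i] is; the added [g] keeps the
   base above 1 when [f] vanishes. With [z = g + 2] the count fits in one digit. *)
pose F v := pack (z v ^ (f v + g v)) (g v) (fun=> 1).
apply: (@rep_ext _ (fun v => F v %% (z v ^ g v - 1) %% z v)).
  move=> v; rewrite -count_dvd_mul // /F /pack.
  under eq_bigr do rewrite -expnM mulnC.
  under eq_bigr do rewrite mulnC.
  rewrite (@sum_mod_pred _ (fun=> 1) (fun i : 'I_(g v) => (f v + g v) * i)) //.
    by apply: eq_bigl => i; rewrite mulnDl dvdn_addl // dvdn_mulr.
  by rewrite sum_nat_const card_ord muln1.
have rz : rep z by rewrite /z; auto with rep.
have : rep F; last by auto with rep.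
apply: rep_pack1; auto with rep => v.
by rewrite -{1}(expn0 (z v)) ltn_exp2l // addn_gt0 g0 orbT.
Qed.

(* [2 ^ s - 1] being [c], one has [(2 ^ l) ^ s = (1 + c) ^ l = 1 + l * c] modulo
   [c ^ 2]. *)
Lemma log2_mod l s : l < 2 ^ s - 1 ->
  ((2 ^ l) ^ s %% (2 ^ s - 1) ^ 2 - 1) %/ (2 ^ s - 1) = l.
Proof.
move=> ls; set c := 2 ^ s - 1 in ls *; have c0 : 0 < c := leq_ltn_trans (leq0n _) ls.
have e : 2 ^ s = 1 + c by rewrite subnKC // expn_gt0.
suff -> : (2 ^ l) ^ s %% c ^ 2 = (1 + l * c) %% c ^ 2.
  case: (leqP c 1) => [c1|c1].
    have -> : l = 0 by lia.
    by rewrite (_ : c = 1) ?modn1 //; lia.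
  by rewrite modn_small ?addKn ?mulnK //; nia.
rewrite -expnM mulnC expnM e; elim: l {ls} => // l IH.
rewrite expnS -modnMmr IH modnMmr.
have -> : (1 + c) * (1 + l * c) = 1 + l.+1 * c + l * c ^ 2 by nia.
by rewrite addnC modnMDl.
Qed.

(** * Binary digit sum *)

(* The number of binary digits [1] of [n], by Kummer's theorem. *)
Definition hw n := logn 2 'C(n.*2, n).

Lemma logn_fact2 n : logn 2 (n.*2)`! = n + logn 2 n`!.
Proof.
elim: n => // n IH; rewrite doubleS !factS mulnA.
rewrite !lognM ?fact_gt0 ?muln_gt0 // IH -doubleS -muln2 lognM // /=.
have -> : logn 2 n.*2.+1 = 0 by apply/eqP; rewrite lognE /= dvdn2 /= odd_double.
by rewrite [logn 2 2]logn_prime //=; lia.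
Qed.

(** Legendre's formula, obtained by comparing the powers of 2 in the factorials that define the
    central binomial coefficient. The recursion [hwS] on the last binary digit, which identifies
    [hw] as a digit sum, follows from it. *)
Lemma hw_fact n : hw n + logn 2 n`! = n.
Proof.
have : logn 2 ('C(n.*2, n) * (n`! * (n.*2 - n)`!)) = logn 2 (n.*2)`!.
  by rewrite bin_fact // -addnn leq_addr.
have c0 : 0 < 'C(n.*2, n) by rewrite bin_gt0 -addnn leq_addr.
have -> : n.*2 - n = n by rewrite -addnn addnK.
rewrite !lognM ?muln_gt0 ?fact_gt0 // logn_fact2 -/(hw n).
by lia.
Qed.

Lemma leq_hw n : hw n <= n.
Proof. by rewrite -{2}(hw_fact n) leq_addr. Qed.

Lemma hw0 : hw 0 = 0.
Proof. by have := leq_hw 0; lia. Qed.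

Lemma hw1 : hw 1 = 1.
Proof. by have := hw_fact 1; rewrite logn1 addn0. Qed.

Lemma hwS (b : bool) n : hw (b + n.*2) = b + hw n.
Proof.
have h0 := hw_fact n; case: b; rewrite ?add1n ?add0n.
  have := hw_fact n.*2.+1; rewrite factS lognM ?fact_gt0 // logn_fact2.
  have -> : logn 2 n.*2.+1 = 0 by apply/eqP; rewrite lognE /= dvdn2 /= odd_double.
  by lia.
by have := hw_fact n.*2; rewrite logn_fact2; lia.
Qed.

Lemma hwD w a b : a < 2 ^ w -> hw (a + b * 2 ^ w) = hw a + hw b.
Proof.
elim: w a => [|w IH] a lt_a.
  by rewrite (_ : a = 0) ?hw0 ?muln1 //; lia.
have lt_a2 : a./2 < 2 ^ w by move: lt_a; rewrite expnS; lia.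
rewrite -{1 2}(odd_double_half a) hwS.
have -> : odd a + (a./2).*2 + b * 2 ^ w.+1 = odd a + (a./2 + b * 2 ^ w).*2.
  by rewrite expnS; lia.
by rewrite hwS IH // addnA.
Qed.

Lemma hw_pack w n c : (forall i, i < n -> c i < 2 ^ w) ->
  hw (pack (2 ^ w) n c) = \sum_(i < n) hw (c i).
Proof.
elim: n => [|n IH] lt_c; first by rewrite /pack !big_ord0 hw0.
have lt_c' i : i < n -> c i < 2 ^ w by move=> lt_in; apply/lt_c/ltnW.
by rewrite packSr big_ord_recr -expnM hwD ?IH // expnM pack_lt.
Qed.

(* Adding [2 ^ w] makes the digit sum reveal the top digit of [c]; summed over
   a packed vector, this counts the components that are at least [2 ^ w]. *)
Lemma hw_top w c : c < 2 ^ w.+1 -> hw (c + 2 ^ w) + (2 ^ w <= c) = hw c + 1.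
Proof.
rewrite expnS => lt_c; case: leqP => [le_c|lt_cw].
  have -> : hw c = hw (c - 2 ^ w) + 1.
    by have := @hwD w (c - 2 ^ w) 1; rewrite mul1n subnK // hw1 => -> //; lia.
  have -> : c + 2 ^ w = (c - 2 ^ w) + 2 * 2 ^ w by lia.
  by rewrite hwD ?(hwS false 1) ?hw1 //; lia.
by rewrite -{1}(mul1n (2 ^ w)) hwD // hw1 addn0.
Qed.

(** In [z ^ (n + 1) * (z + 1) ^ (2 * n)] the coefficient ['C(2 * n, i)] stands at exponent
    [3 * n + 1 - i], between [n + 1] and [3 * n + 1]; the only multiple of [2 * n + 1] in this range
    is reached at [i = n]. *)
Lemma rep_bin m (f : m.-tuple nat -> nat) :
  rep f -> rep (fun v => 'C((f v).*2, f v)).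
Proof.
move=> rf; pose z v := 2 ^ (2 * f v).+2; pose k v := (2 * f v).+1.
apply: (@rep_ext _ (fun v => (z v ^ (f v).+1 * (z v).+1 ^ (2 * f v)) %%
                             (z v ^ k v - 1) %% z v)); last first.
  by rewrite /z /k; auto 20 with rep.
move=> v; rewrite -(addn1 (z v)) expnDn big_distrr /=.
set n := f v.
pose c (i : 'I_(2 * n).+1) := 'C(2 * n, i).
pose e (i : 'I_(2 * n).+1) := n.+1 + (2 * n - i).
rewrite (eq_bigr (fun i => c i * z v ^ e i)); last first.
  by move=> i _; rewrite exp1n muln1 mulnCA -expnD.
have sumc : \sum_i c i = 2 ^ (2 * n).
  rewrite -[2]/(1 + 1)%N Pascal; apply: eq_bigr => i _.
  by rewrite !exp1n !muln1.
rewrite sum_mod_pred //; last first.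
  rewrite sumc /z -/n !expnS; have : 0 < 2 ^ (2 * n) by rewrite expn_gt0.
  by lia.
have ltn : n < (2 * n).+1 by lia.
rewrite (big_pred1 (Ordinal ltn)) /c /=; first by rewrite mul2n.
move=> i; rewrite /e /k /= -val_eqE -/n /=; have := ltn_ord i => {c e sumc} lt_i.
apply/dvdnP/eqP => [[q]|->]; last by exists 1; lia.
by case: q => [|[|q]]; rewrite ?mulSn; lia.
Qed.

Lemma gcdn_pow2 x m : 0 < x -> x < 2 ^ m -> gcdn x (2 ^ m) = 2 ^ logn 2 x.
Proof.
move=> x0 lt_x; have [o co ex] := pfactor_coprime (isT : prime 2) x0.
have le_lm : logn 2 x <= m.
  have o0 : 0 < o by move: x0; rewrite ex muln_gt0 => /andP[].
  rewrite -(@leq_exp2l 2) // ltnW // (leq_ltn_trans _ lt_x) //.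
  by rewrite [leqRHS]ex leq_pmull.
rewrite {1}ex -{1}(subnK le_lm) expnD -muln_gcdl (eqP (_ : coprime o _)) ?mul1n //.
by rewrite coprime_sym coprimeXl.
Qed.

(** Since [0 < b < 2 ^ b], the gcd of [b] with [2 ^ b] is the full power of 2 in [b]. Its exponent
    is at most [f v], small enough for [log2_mod] to read it off. *)
Lemma rep_hw m (f : m.-tuple nat -> nat) : rep f -> rep (fun v => hw (f v)).
Proof.
move=> rf; pose b v := 'C((f v).*2, f v); pose c v := 2 ^ (f v).+2 - 1.
have rb : rep b by apply: rep_bin.
have rc : rep c by rewrite /c; auto with rep.
have rg : rep (fun v => gcdn (b v) (2 ^ b v)).
  by apply: rep_gcd; auto with rep => v; rewrite expn_gt0.
apply: (@rep_ext _ (fun v =>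
  ((gcdn (b v) (2 ^ b v)) ^ (f v).+2 %% c v ^ 2 - 1) %/ c v)); last first.
  by auto 20 with rep.
move=> v; have b0 : 0 < b v by rewrite bin_gt0 -addnn leq_addr.
have lt_b : b v < 2 ^ b v; first by apply: ltn_expl.
have lb : logn 2 (b v) < c v.
  have h := leq_hw (f v); have := ltn_expl (f v) (isT : 1 < 2).
  by rewrite /c -/(hw _) !expnS; lia.
by rewrite (gcdn_pow2 b0 lt_b) (log2_mod lb).
Qed.

(** * Spreading binary digits *)

Lemma pack_expl q n y : pack q n (fun i => y ^ i) = pack (y * q) n (fun=> 1).
Proof. by apply: eq_bigr => i _; rewrite mul1n expnMn. Qed.

(** A four-dimensional array in one number: [t] digits in base [q ^ t ^ k] fill exactly one digit in
    base [q ^ t ^ k.+1]. By [box_sep], the array of a product of functions of single indices is a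
    product of one-dimensional packs, hence has a closed form. *)
Definition box (q n t : nat) (c : nat -> nat -> nat -> nat -> nat) : nat :=
  pack (q ^ t ^ 3) n (fun i => pack (q ^ t ^ 2) t (fun a =>
    pack (q ^ t) t (fun e => pack q t (fun u => c i a e u)))).

Lemma eq_box q n t c d :
  (forall i a e u, c i a e u = d i a e u) -> box q n t c = box q n t d.
Proof. by move=> cd; do 4!apply: eq_pack => ? _. Qed.

Lemma boxD q n t c d :
  box q n t (fun i a e u => c i a e u + d i a e u) = box q n t c + box q n t d.
Proof. by do 4![rewrite -packD; apply: eq_pack => ? _]. Qed.

Lemma boxB q n t c d :
  (forall i a e u, i < n -> a < t -> e < t -> u < t -> d i a e u <= c i a e u) ->
  box q n t (fun i a e u => c i a e u - d i a e u) = box q n t c - box q n t d.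
Proof.
move=> dc; rewrite -packB => [|i lt_i]; last by do 3!apply: leq_pack => ? ?; apply: dc.
apply: eq_pack => i lt_i.
rewrite -packB => [|a lt_a]; last by do 2!apply: leq_pack => ? ?; apply: dc.
apply: eq_pack => a lt_a.
rewrite -packB => [|e lt_e]; last by apply: leq_pack => ? ?; apply: dc.
by apply: eq_pack => e lt_e; rewrite -packB // => u lt_u; apply: dc.
Qed.

Lemma box_sep q n t (f g h k : nat -> nat) :
  box q n t (fun i a e u => f i * (g a * (h e * k u))) =
  pack (q ^ t ^ 3) n f * (pack (q ^ t ^ 2) t g * (pack (q ^ t) t h * pack q t k)).
Proof.
rewrite -packMr; apply: eq_pack => i _; rewrite -packMr -packMl.
apply: eq_pack => a _; rewrite -packMr -!packMl.
by apply: eq_pack => e _; rewrite -!packMl.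
Qed.

Lemma boxMl q n t k c :
  box q n t (fun i a e u => k * c i a e u) = k * box q n t c.
Proof. by do 4![rewrite -packMl; apply: eq_pack => ? _]. Qed.

Lemma hw_box w n t c :
  (forall i a e u, i < n -> a < t -> e < t -> u < t -> c i a e u < 2 ^ w) ->
  hw (box (2 ^ w) n t c) =
  \sum_(i < n) \sum_(a < t) \sum_(e < t) \sum_(u < t) hw (c i a e u).
Proof.
move=> lt_c; have q1 a e i : i < n -> a < t -> e < t ->
    pack (2 ^ w) t (fun u => c i a e u) < (2 ^ w) ^ t.
  by move=> *; apply: pack_lt => *; apply: lt_c.
have q2 a i : i < n -> a < t ->
    pack ((2 ^ w) ^ t) t (fun e => pack (2 ^ w) t (fun u => c i a e u)) < (2 ^ w) ^ t ^ 2.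
  by move=> lt_i lt_a; rewrite -mulnn expnM; apply: pack_lt => e lt_e; apply: q1.
have q3 i : i < n ->
    pack ((2 ^ w) ^ t ^ 2) t (fun a => pack ((2 ^ w) ^ t) t
      (fun e => pack (2 ^ w) t (fun u => c i a e u))) < (2 ^ w) ^ t ^ 3.
  move=> lt_i; rewrite [t ^ 3]expnSr [ltnRHS]expnM.
  by apply: pack_lt => a lt_a; apply: q2.
rewrite /box -[in pack ((2 ^ w) ^ t ^ 3)]expnM hw_pack; last first.
  by move=> i; rewrite expnM; apply: q3.
apply: eq_bigr => i _; rewrite -[in pack ((2 ^ w) ^ t ^ 2)]expnM hw_pack; last first.
  by move=> a; rewrite expnM; apply: q2.
apply: eq_bigr => a _; rewrite -[in pack ((2 ^ w) ^ t)]expnM hw_pack; last first.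
  by move=> e; rewrite expnM; apply: q1.
by apply: eq_bigr => e _; rewrite hw_pack // => u; apply: lt_c.
Qed.

Lemma sum_ltn_ord n k : k <= n -> \sum_(i < n) (i < k : nat) = k.
Proof.
move=> le_kn; rewrite -[RHS]card_ord -sum1_card (big_ord_widen n (fun=> 1) le_kn).
by rewrite [RHS]big_mkcond; apply: eq_bigr => i _; case: ltnP.
Qed.

Lemma sum_pred1_ord a n k : k <= n -> \sum_(i < n) (a.+1 + i == k : nat) = (a < k).
Proof.
move=> le_kn; case: ltnP => [lt_ak|le_ka]; last first.
  by rewrite big1 // => i _; apply/eqP; rewrite eqb0; lia.
have lt : k - a.+1 < n by lia.
rewrite (bigD1 (Ordinal lt)) //= subnKC // eqxx big1 // => i.
by rewrite -val_eqE /= => ne; apply/eqP; rewrite eqb0; lia.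
Qed.

(* Lexicographically, [lhs i a e u <= rhs x i] means that [e + 1 + u < y ^ i], or
   that [e + 1 + u = y ^ i] and [(a + 1) * 2 ^ i <= x].  There are [y ^ i] pairs
   [(e, u)] with [e + 1 + u = y ^ i], so [count x - count 0] is the sum of
   [x %/ 2 ^ i] with weights [y ^ i]. *)
Section Weighted.
Variables (y n x t h w : nat).

Definition lhs i a e u := h * (e + 1 + u) + (a + 1) * 2 ^ i.
Definition rhs (z i : nat) := h * y ^ i + z.
(** The offset [2 ^ w] makes the subtraction exact, and the value is at least [2 ^ w] exactly when
    the inequality holds: the situation of [hw_top]. *)
Definition gap z i a e u := 2 ^ w + rhs z i - lhs i a e u.
Definition count z := \sum_(i < n) \sum_(a < t) \sum_(e < t) \sum_(u < t)
  (lhs i a e u <= rhs z i : nat).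

(** The order is lexicographic because [h] exceeds [x] and is at least every [(a + 1) * 2 ^ i]; [t]
    is large enough for the ranges of [a], [e], [u] to contain all solutions to be counted, and
    [2 ^ w] dominates both sides. *)
Hypotheses (yt : y ^ n <= t) (y0 : 0 < y) (xt : x <= t) (xh : x < h) (th : t * 2 ^ n <= h)
  (wh : h * (2 * t + 2) <= w).

Let yi i : i < n -> y ^ i <= t.
Proof. by move=> lt_in; apply: leq_trans yt; rewrite leq_pexp2l // ltnW. Qed.

Let ai a i : i < n -> a < t -> (a + 1) * 2 ^ i <= h.
Proof.
by move=> lt_in lt_a; apply: leq_trans th; rewrite leq_mul ?leq_pexp2l ?addn1 // ltnW.
Qed.

Lemma lhs_lt i a e u : i < n -> a < t -> e < t -> u < t -> lhs i a e u < 2 ^ w.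
Proof.
move=> lt_i lt_a lt_e lt_u; have := ai lt_i lt_a.
have := ltn_expl w (isT : 1 < 2); rewrite /lhs.
set s := _ * 2 ^ i; nia.
Qed.

Let rhs_lt z i : z <= x -> i < n -> rhs z i < 2 ^ w.
Proof.
move=> zx lt_i; have := yi lt_i; have := ltn_expl w (isT : 1 < 2).
by rewrite /rhs; set s := y ^ i; nia.
Qed.

Lemma count_hw z : z <= x ->
  hw (box (2 ^ w.+2) n t (fun i a e u => gap z i a e u + 2 ^ w)) + count z =
  hw (box (2 ^ w.+2) n t (gap z)) + n * (t * (t * t)).
Proof.
move=> zx; rewrite !hw_box; first last.
- by move=> i a e u lt_i _ _ _; have := rhs_lt zx lt_i; rewrite /gap !expnS; lia.
- by move=> i a e u lt_i _ _ _; have := rhs_lt zx lt_i; rewrite /gap !expnS; lia.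
have -> : n * (t * (t * t)) =
    \sum_(i < n) \sum_(a < t) \sum_(e < t) \sum_(u < t) 1.
  by rewrite !sum_nat_const !card_ord muln1.
rewrite /count -!big_split; apply: eq_bigr => i _; rewrite -!big_split.
apply: eq_bigr => a _; rewrite -!big_split; apply: eq_bigr => e _.
rewrite -!big_split; apply: eq_bigr => u _ /=.
have l := lhs_lt (ltn_ord i) (ltn_ord a) (ltn_ord e) (ltn_ord u).
have r := rhs_lt zx (ltn_ord i).
rewrite -(@hw_top w); last by rewrite /gap expnS; lia.
by congr (_ + nat_of_bool _); rewrite /gap; apply/idP/idP; lia.
Qed.

Lemma count_diff : count x = count 0 + pack y n (fun i => x %/ 2 ^ i).
Proof.
rewrite /count /pack -big_split; apply: eq_bigr => i _ /=.
have -> : x %/ 2 ^ i = \sum_(a < t) ((a + 1) * 2 ^ i <= x).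
  have le_t : x %/ 2 ^ i <= t by apply: leq_trans xt; apply: leq_div.
  under eq_bigr => a _ do rewrite -leq_divRL ?expn_gt0 // addn1.
  by rewrite sum_ltn_ord.
rewrite big_distrl -big_split; apply: eq_bigr => a _ /=.
have ha := ai (ltn_ord i) (ltn_ord a); have hi := yi (ltn_ord i).
have -> : y ^ i = \sum_(e < t) \sum_(u < t) (e.+1 + u == y ^ i : nat).
  by rewrite -{1}(sum_ltn_ord hi); apply: eq_bigr => e _; rewrite -(sum_pred1_ord e hi).
rewrite big_distrr -big_split; apply: eq_bigr => e _ /=.
rewrite big_distrr -big_split; apply: eq_bigr => u _ /=.
have i0 : 0 < 2 ^ i by rewrite expn_gt0.
have s0 : 0 < (a + 1) * 2 ^ i by rewrite muln_gt0 addn1.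
rewrite /lhs /rhs -[e.+1]addn1; move: ha s0 {i0}; set s := _ * 2 ^ i => ha s0.
set E := e + 1 + u; set Y := y ^ i; rewrite addn0.
have [EY|EY|->] := ltngtP E Y.
- rewrite muln0 addn0; have : h * E + h <= h * Y by nia.
  by move=> EhY; congr (nat_of_bool _); apply/idP/idP; lia.
- rewrite muln0 addn0; have : h * Y + h <= h * E by nia.
  by move=> EhY; congr (nat_of_bool _); apply/idP/idP; lia.
- by rewrite muln1 leq_add2l; lia.
Qed.

Definition one (q k : nat) := pack q k (fun=> 1).

(** Each summand of [gap] is a product of functions of single indices, so [box_sep] applies; a
    factor [y ^ i] or [2 ^ i] merely multiplies the ratio of a geometric sum. *)
Lemma box_gap q z :
  let p2 := q ^ t ^ 2 in let p1 := q ^ t in let p3 := q ^ t ^ 3 in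
  box q n t (gap z) =
  (2 ^ w + z) * (one p3 n * (one p2 t * (one p1 t * one q t)))
  + h * (one (y * p3) n * (one p2 t * (one p1 t * one q t)))
  - (h * (one p3 n * (one p2 t * (pack p1 t id * one q t)))
     + h * (one p3 n * (one p2 t * (one p1 t * one q t)))
     + h * (one p3 n * (one p2 t * (one p1 t * pack q t id)))
     + (one (2 * p3) n * (pack p2 t id * (one p1 t * one q t))
        + one (2 * p3) n * (one p2 t * (one p1 t * one q t)))).
Proof.
rewrite /= /one -!pack_expl -!box_sep -!boxMl -!boxD -boxB.
  by apply: eq_box => i a e u; rewrite /gap /lhs /rhs; congr (_ - _); nia.
move=> i a e u lt_i lt_a lt_e lt_u; have := lhs_lt lt_i lt_a lt_e lt_u.
by rewrite /lhs /=; move: (2 ^ w) (2 ^ i) => W I; nia.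
Qed.

Lemma shifts_count q : q = 2 ^ w.+2 ->
  let c z := hw (box q n t (gap z)) + n * (t * (t * t))
    - hw (box q n t (gap z)
       + 2 ^ w * (one (q ^ t ^ 3) n * (one (q ^ t ^ 2) t * (one (q ^ t) t * one q t)))) in
  c x - c 0 = pack y n (fun i => x %/ 2 ^ i).
Proof.
move=> -> c; suff cE z : z <= x -> c z = count z by rewrite !cE // count_diff addKn.
move=> zx; rewrite /c -box_sep -boxMl -boxD -(count_hw zx).
set b := box _ _ _ _; set b' := box _ _ _ _; rewrite (_ : b = b') ?addKn //.
by apply: eq_box => i a e u; rewrite /= !muln1.
Qed.

End Weighted.

Lemma rep_shifts m (x y n : m.-tuple nat -> nat) : (forall v, 1 < y v) ->
  rep x -> rep y -> rep n ->
  rep (fun v => pack (y v) (n v) (fun i => x v %/ 2 ^ i)).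
Proof.
move=> y1 rx ry rn; pose t v := x v + y v ^ n v + 1.
pose h v := x v + t v * 2 ^ n v + 1; pose w v := h v * (2 * t v + 2).
have rt : rep t by rewrite /t; auto 20 with rep.
have rh : rep h by rewrite /h; auto 20 with rep.
have rw : rep w by rewrite /w; auto 20 with rep.
pose q v := 2 ^ (w v).+2.
have rq : rep q by rewrite /q; auto 20 with rep.
have q1 v : 1 < q v by rewrite /q -{1}(expn0 2) ltn_exp2l.
have qt v k : 1 < q v ^ t v ^ k.
  by rewrite -{1}(expn0 (q v)) ltn_exp2l // expn_gt0 /t addn1.
have qt1 v : 1 < q v ^ t v by have := qt v 1; rewrite expn1.
have y0 v : 0 < y v := ltnW (y1 v).
have [yt xt] : (forall v, y v ^ n v <= t v) /\ (forall v, x v <= t v).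
  by split=> v; rewrite /t; lia.
have [th xh] : (forall v, t v * 2 ^ n v <= h v) /\ (forall v, x v < h v).
  by split=> v; rewrite /h; lia.
have wh v : h v * (2 * t v + 2) <= w v by [].
have rone a b : (forall v, 1 < a v) -> rep a -> rep b -> rep (fun v => one (a v) (b v)).
  exact: rep_pack1.
have gt1 z v k : 0 < z -> 1 < z * q v ^ t v ^ k by have := qt v k; nia.
have r1 : rep (fun v => one (q v) (t v)) by auto.
have r1' : rep (fun v => pack (q v) (t v) id) by apply: rep_packid.
have r1t : rep (fun v => one (q v ^ t v) (t v)) by apply: rone; auto with rep.
have r1't : rep (fun v => pack (q v ^ t v) (t v) id) by apply: rep_packid; auto with rep.
have r2 k : rep (fun v => one (q v ^ t v ^ k) (t v)) by apply: rone; auto with rep.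
have r3 k : rep (fun v => pack (q v ^ t v ^ k) (t v) id).
  by apply: rep_packid; auto with rep.
have r4 z k : (forall v, 0 < z v) -> rep z ->
    rep (fun v => one (z v * q v ^ t v ^ k) (n v)).
  by move=> *; apply: rone; auto with rep.
have r5 k : rep (fun v => one (q v ^ t v ^ k) (n v)) by apply: rone; auto with rep.
have r6 : rep (fun v => one (2 * q v ^ t v ^ 3) (n v)).
  by apply: (r4 (fun=> 2)); auto with rep.
have r7 : rep (fun v => one (y v * q v ^ t v ^ 3) (n v)) by apply: r4.
have rbox e : rep e -> rep (fun v => box (q v) (n v) (t v) (gap (y v) (h v) (w v) (e v))).
  move=> re; apply: rep_ext (fun v => esym (box_gap (yt v) (y0 v) (xt v) (xh v)
    (th v) (wh v) (q v) (e v))) _.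
  by auto 50 with rep.
apply: rep_ext (fun v => shifts_count (yt v) (y0 v) (xt v) (xh v) (th v) (wh v)
  (erefl (q v))) _.
have rb0 : rep (fun v => box (q v) (n v) (t v) (gap (y v) (h v) (w v) 0)).
  by apply: (rbox (fun=> 0)); auto with rep.
have rbx := rbox x rx.
have rhw' (a b : m.-tuple nat -> nat) : rep a -> rep b -> rep (fun v => hw (a v + b v)).
  by move=> ra rb; apply: (rep_hw (rep_add ra rb)).
have := (rep_hw rb0, rep_hw rbx) => -[rh0 rhx].
by auto 50 with rep.
Qed.

Definition bit (x i : nat) : nat := x %/ 2 ^ i %% 2.

(** Bit [i] is [x %/ 2 ^ i] minus twice [x %/ 2 %/ 2 ^ i], so the spread digits are a difference of
    two packs of shifts. *)
Lemma rep_bits m (x y n : m.-tuple nat -> nat) : (forall v, 1 < y v) ->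
  rep x -> rep y -> rep n -> rep (fun v => pack (y v) (n v) (bit (x v))).
Proof.
move=> y1 rx ry rn.
apply: (@rep_ext _ (fun v => pack (y v) (n v) (fun i => x v %/ 2 ^ i)
  - 2 * pack (y v) (n v) (fun i => x v %/ 2 %/ 2 ^ i))).
  move=> v; rewrite -packMl -packB => [|i _].
    by apply: eq_pack => i _; rewrite /bit -divnMA [2 * 2 ^ i]mulnC divnMA; lia.
  by rewrite -divnMA [2 * 2 ^ i]mulnC divnMA; lia.
have r2 : rep (fun v => x v %/ 2) by auto with rep.
have := (rep_shifts y1 rx ry rn, rep_shifts y1 r2 ry rn) => -[? ?].
by auto with rep.
Qed.

(** * Bitwise conjunction *)

(** The length [x] is a safe number of digits, as [x < 2 ^ x]; [landE] exchanges it for any other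
    sufficient length. *)
Definition land (x y : nat) : nat := pack 2 x (fun i => bit x i * bit y i).

Lemma bit_small n x i : x < 2 ^ n -> n <= i -> bit x i = 0.
Proof.
by move=> lt_x le_i; rewrite /bit divn_small // (leq_trans lt_x) // leq_pexp2l.
Qed.

Lemma landE n x y : x < 2 ^ n -> land x y = pack 2 n (fun i => bit x i * bit y i).
Proof.
have widen k p : x < 2 ^ k ->
    pack 2 (k + p) (fun i => bit x i * bit y i) = pack 2 k (fun i => bit x i * bit y i).
  move=> lt_x; elim: p => [|p IH]; first by rewrite addn0.
  by rewrite addnS packSr IH (bit_small lt_x) ?leq_addr // !mul0n addn0.
have lt_xx : x < 2 ^ x by rewrite ltn_expl.
by move=> lt_x; rewrite -(widen n x lt_x) addnC (widen x n lt_xx).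
Qed.

(* With [k] congruent to [-1] modulo [n + 1], the product of the two spread numbers
   has [bit x i * 2 ^ i * bit y j] in front of a power of [z] whose exponent is
   congruent to [i - j], so [sum_mod_pred] extracts the terms with [i = j]. *)
Lemma rep_land m (x y : m.-tuple nat -> nat) :
  rep x -> rep y -> rep (fun v => land (x v) (y v)).
Proof.
move=> rx ry; pose n := x; pose z v := n v * (n v * 2 ^ n v) + 2.
pose k v := n v + n v + 1.
apply: (@rep_ext _ (fun v =>
  (pack (2 * z v) (n v) (bit (x v)) * pack (z v ^ k v) (n v) (bit (y v)))
  %% (z v ^ (n v).+1 - 1) %% z v)); last first.
  have z1 v : 1 < z v by rewrite /z addn2.
  have rz : rep z by rewrite /z; auto 20 with rep.
  have rk : rep k by rewrite /k; auto 20 with rep.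
  have : rep (fun v => pack (2 * z v) (n v) (bit (x v))).
    by apply: rep_bits; auto with rep => v; have := z1 v; lia.
  have : rep (fun v => pack (z v ^ k v) (n v) (bit (y v))).
    apply: rep_bits; auto with rep => v.
    by rewrite -{1}(expn0 (z v)) ltn_exp2l // /k addn1.
  by auto 20 with rep.
move=> v; set N := n v; set X := x v; set Y := y v; set Z := z v.
pose c (p : 'I_N * 'I_N) := bit X p.1 * 2 ^ p.1 * bit Y p.2.
pose e (p : 'I_N * 'I_N) := p.1 + k v * p.2.
have b1 a i : bit a i <= 1 by rewrite /bit -ltnS ltn_pmod.
have -> : pack (2 * Z) N (bit X) * pack (Z ^ k v) N (bit Y) = \sum_p c p * Z ^ e p.
  rewrite /pack big_distrlr pair_bigA; apply: eq_bigr => -[i j] _.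
  by rewrite /c /e /= expnD expnM expnMn !mulnA; congr muln; apply: mulnAC.
rewrite sum_mod_pred //; last first.
  apply: (@leq_ltn_trans (\sum_(p : 'I_N * 'I_N) 2 ^ N).+1).
    rewrite ltnS; apply: leq_sum => -[i j] _; rewrite /c /=.
    by rewrite -(muln1 (2 ^ N)) -(mul1n (2 ^ N)) !leq_mul // leq_pexp2l // ltnW.
  by rewrite sum_nat_const card_prod card_ord /Z /z -/N; nia.
rewrite /land -/X /pack; rewrite -[X in \sum_(i < X) _]/N.
rewrite (eq_bigl (fun p => p.2 == p.1)); last first.
  move=> [i j]; rewrite /e /k -/N /= -val_eqE /=.
  have := (ltn_ord i, ltn_ord j) => -[li lj].
  apply/dvdnP/eqP => [[d]|->]; last by exists (2 * i); lia.
  move=> E; suff : d = 2 * j by move=> dj; move: E; rewrite dj; lia.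
  nia.
rewrite -(pair_big_dep xpredT (fun i j : 'I_N => j == i) (fun i j => c (i, j))) /=.
apply: eq_bigr => i _; rewrite big_pred1_eq /c /=.
by rewrite mulnAC.
Qed.

Lemma bitS (b : bool) x i : bit (b + x.*2) i.+1 = bit x i.
Proof. by rewrite /bit expnS divnMA; congr (_ %/ _ %% _); lia. Qed.

Lemma bit0 (b : bool) x : bit (b + x.*2) 0 = b.
Proof. by rewrite /bit divn1; lia. Qed.

Lemma land_double (a b : bool) x y :
  land (a + x.*2) (b + y.*2) = (a && b) + (land x y).*2.
Proof.
have lt_x : x < 2 ^ x by rewrite ltn_expl.
rewrite (@landE x.+1); last by rewrite expnS; lia.
rewrite packS !bit0 mulnb mul2n; congr (_ + _.*2).
by apply: eq_pack => i _; rewrite !bitS.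
Qed.

Lemma land0x y : land 0 y = 0. Proof. by rewrite /land /pack big_ord0. Qed.

Lemma landx0 x : land x 0 = 0.
Proof. by rewrite /land /pack big1 // => i _; rewrite /bit div0n muln0. Qed.

Lemma landD w x y x' y' : x < 2 ^ w -> y < 2 ^ w ->
  land (x + x' * 2 ^ w) (y + y' * 2 ^ w) = land x y + land x' y' * 2 ^ w.
Proof.
elim: w x y => [|w IH] x y lt_x lt_y.
  by rewrite !muln1 (_ : x = 0) 1?(_ : y = 0) ?land0x //; lia.
have E z z' : z + z' * 2 ^ w.+1 = odd z + (z./2 + z' * 2 ^ w).*2.
  by rewrite expnS; lia.
rewrite !E !land_double IH; try by move: lt_x lt_y; rewrite expnS; lia.
have -> : land x y = (odd x && odd y) + (land x./2 y./2).*2.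
  by rewrite -land_double !odd_double_half.
by case: (_ && _); lia.
Qed.

Lemma leq_land x y : land x y <= x.
Proof.
have lt_x : x < 2 ^ x by rewrite ltn_expl.
rewrite -[leqRHS](pack_digits lt_x); apply: leq_pack => i _.
have : bit y i <= 1 by rewrite -ltnS ltn_pmod.
by rewrite -/(bit x i) /=; nia.
Qed.

Lemma land_pack w n c d : (forall i, i < n -> c i < 2 ^ w) ->
  (forall i, i < n -> d i < 2 ^ w) ->
  land (pack (2 ^ w) n c) (pack (2 ^ w) n d) = pack (2 ^ w) n (fun i => land (c i) (d i)).
Proof.
elim: n => [|n IH] lt_c lt_d; first by rewrite /pack !big_ord0 land0x.
have lt_c' i : i < n -> c i < 2 ^ w by move=> lt_in; apply/lt_c/ltnW.
have lt_d' i : i < n -> d i < 2 ^ w by move=> lt_in; apply/lt_d/ltnW.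
by rewrite !packSr -expnM landD ?IH // expnM pack_lt.
Qed.

Lemma land_ones s x : x < 2 ^ s -> land x (2 ^ s - 1) = x.
Proof.
elim: s x => [|s IH] x lt_x; first by rewrite landx0; lia.
have s0 : 0 < 2 ^ s by rewrite expn_gt0.
have -> : 2 ^ s.+1 - 1 = true + (2 ^ s - 1).*2 by rewrite expnS /=; lia.
rewrite -{1}(odd_double_half x) land_double IH; first by rewrite andbT odd_double_half.
by move: lt_x; rewrite expnS; lia.
Qed.

Lemma land_low s x : land x (2 ^ s - 1) = x %% 2 ^ s.
Proof.
have s0 : 0 < 2 ^ s by rewrite expn_gt0.
have lt1 : 2 ^ s - 1 < 2 ^ s by lia.
have := landD (x %/ 2 ^ s) 0 (ltn_pmod x s0) lt1.
by rewrite addnC -divn_eq landx0 land_ones ?ltn_pmod // !mul0n !addn0.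
Qed.

Lemma land_high w s x : x < 2 ^ w -> land x (2 ^ w - 2 ^ s) = x %/ 2 ^ s * 2 ^ s.
Proof.
move=> lt_x; have s0 : 0 < 2 ^ s by rewrite expn_gt0.
case: (leqP s w) => [le_sw|lt_ws]; last first.
  have lt : 2 ^ w < 2 ^ s by rewrite ltn_exp2l.
  rewrite (_ : 2 ^ w - 2 ^ s = 0) ?landx0 ?divn_small //; last by lia.
  exact: ltn_trans lt.
have -> : 2 ^ w - 2 ^ s = 0 + (2 ^ (w - s) - 1) * 2 ^ s.
  by rewrite mulnBl mul1n -expnD subnK.
rewrite {1}(divn_eq x (2 ^ s)) addnC landD ?ltn_pmod // landx0 land_ones //.
by rewrite ltn_divLR // -expnD subnK.
Qed.

(** * Parallel evaluation *)

#[export] Hint Resolve rep_land : rep.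

(* Functions of parameters [v] and variables [e] that can be computed on all the
   components of packed vectors at once (see [lift_circ]). *)
Inductive circ m : (m.-tuple nat -> (nat -> nat) -> nat) -> Prop :=
| circ_ext f g : (forall v e, f v e = g v e) -> circ f -> circ g
| circ_var l : circ (fun _ e => e l)
| circ_const c : rep c -> circ (fun v _ => c v)
| circ_add f g : circ f -> circ g -> circ (fun v e => f v e + g v e)
| circ_mul c f : rep c -> circ f -> circ (fun v e => c v * f v e)
| circ_sub f g : circ f -> circ g -> circ (fun v e => f v e - g v e)
| circ_land f g : circ f -> circ g -> circ (fun v e => land (f v e) (g v e))
| circ_shr s f : rep s -> circ f -> circ (fun v e => f v e %/ 2 ^ s v).

Create HintDb circ.
#[export] Hint Resolve circ_var circ_const circ_add circ_mul circ_sub circ_land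
  circ_shr : circ.

Lemma circ_comp m (f : m.-tuple nat -> (nat -> nat) -> nat)
    (g : nat -> m.-tuple nat -> (nat -> nat) -> nat) :
  circ f -> (forall l, circ (g l)) -> circ (fun v e => f v (fun l => g l v e)).
Proof.
by move=> cf cg; elim: cf => *; eauto with circ; apply: circ_ext; eauto => v e /=.
Qed.

Lemma rep_circ m (f : m.-tuple nat -> (nat -> nat) -> nat)
    (g : nat -> m.-tuple nat -> nat) :
  circ f -> (forall l, rep (g l)) -> rep (fun v => f v (fun l => g l v)).
Proof.
move=> cf rg; elim: cf => {f} //; try by auto with rep.
by move=> f f' ff' _; apply: rep_ext.
Qed.

Lemma circ_sum m (I : Type) (r : seq I) (f : I -> m.-tuple nat -> (nat -> nat) -> nat) :
  (forall i, circ (f i)) -> circ (fun v e => \sum_(i <- r) f i v e).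
Proof.
move=> cf; elim: r => [|i r IH].
  apply: (@circ_ext _ (fun _ _ => 0)) => [v e|]; first by rewrite big_nil.
  by apply: circ_const; apply: rep_const.
apply: (@circ_ext _ (fun v e => f i v e + \sum_(j <- r) f j v e)) => [v e|].
  by rewrite big_cons.
exact: circ_add.
Qed.

Lemma land_top w d : d < 2 ^ w.+1 -> land d (2 ^ w) = (2 ^ w <= d) * 2 ^ w.
Proof.
move=> lt_d; have := land_high w lt_d; rewrite expnS.
have -> : 2 * 2 ^ w - 2 ^ w = 2 ^ w by lia.
move=> ->; congr muln; move: lt_d; rewrite expnS.
have w0 : 0 < 2 ^ w by rewrite expn_gt0.
case: (leqP (2 ^ w) d) => [le_d|gt_d] lt_2; last by rewrite divn_small.
apply/eqP; rewrite eqn_leq leq_divRL // mul1n le_d andbT.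
by rewrite -ltnS ltn_divLR.
Qed.

Lemma land_sub w f g : f < 2 ^ w -> g < 2 ^ w ->
  land (2 ^ w + f - g) ((2 ^ w <= 2 ^ w + f - g) * (2 ^ w - 1)) = f - g.
Proof.
move=> lt_f lt_g; case: leqP => [le|gt]; last by rewrite mul0n landx0; lia.
rewrite mul1n land_low; have -> : 2 ^ w + f - g = (f - g) + 2 ^ w by lia.
by rewrite modnDr modn_small //; lia.
Qed.

(* Truncated subtraction is the only nontrivial case: [2 ^ w + f - g] stays
   nonnegative, and its digit at [2 ^ w] says whether [g <= f]. *)
Lemma lift_circ m (f : m.-tuple nat -> (nat -> nat) -> nat) (w0 : m.-tuple nat -> nat) :
  circ f -> rep w0 ->
  exists2 w1 : m.-tuple nat -> nat, rep w1 &
  (forall v e, (forall l, e l < 2 ^ w0 v) -> f v e < 2 ^ w1 v) /\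
  forall w n : m.-tuple nat -> nat, rep w -> rep n -> (forall v, w1 v < w v) ->
  exists2 F, circ F & forall v (x : nat -> nat -> nat),
    (forall j l, j < n v -> x j l < 2 ^ w0 v) ->
    F v (fun l => pack (2 ^ w v) (n v) (x^~ l)) =
    pack (2 ^ w v) (n v) (fun j => f v (x j)).
Proof.
move=> cf rw0; elim: cf => {f}.
- move=> f f' ff' _ [w1 rw1 [lt_f H]]; exists w1 => //; split=> [v e lt_e|w n rw rn lt_w].
    by rewrite -ff' lt_f.
  have [F cF FE] := H w n rw rn lt_w; exists F => // v x lt_x.
  by rewrite FE //; apply: eq_pack => j _; rewrite ff'.
- move=> l; exists w0 => //; split=> // w n rw rn lt_w.
  by exists (fun _ e => e l) => //; apply: circ_var.
- move=> c rc; exists c => //; split=> [v e _|w n rw rn lt_w]; first by apply: ltn_expl.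
  exists (fun v _ => c v * pack (2 ^ w v) (n v) (fun=> 1)).
    apply/circ_const/rep_mul => //; apply: rep_pack1; auto with rep => v.
    by rewrite -{1}(expn0 2) ltn_exp2l // (leq_ltn_trans _ (lt_w v)).
  by move=> v x _; rewrite -packMl; apply: eq_pack => j _; rewrite muln1.
- move=> f g _ [wf rwf [lt_f Hf]] _ [wg rwg [lt_g Hg]].
  exists (fun v => wf v + wg v + 1); auto 20 with rep.
  have lt_fg v e : (forall l, e l < 2 ^ w0 v) -> f v e + g v e < 2 ^ (wf v + wg v + 1).
    move=> lt_e; have := (lt_f v e lt_e, lt_g v e lt_e) => -[].
    have : 2 ^ wf v <= 2 ^ (wf v + wg v) by rewrite leq_pexp2l // leq_addr.
    have : 2 ^ wg v <= 2 ^ (wf v + wg v) by rewrite leq_pexp2l // leq_addl.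
    by rewrite addn1 expnS; lia.
  split=> // w n rw rn lt_w.
  have [|F cF FE] := Hf w n rw rn; first by move=> v; have := lt_w v; lia.
  have [|G cG GE] := Hg w n rw rn; first by move=> v; have := lt_w v; lia.
  exists (fun v e => F v e + G v e); first exact: circ_add.
  by move=> v x lt_x; rewrite FE // GE // packD.
- move=> c f rc _ [wf rwf [lt_f Hf]]; exists (fun v => c v + wf v); auto with rep.
  split=> [v e lt_e|w n rw rn lt_w].
    by rewrite expnD; apply: ltn_mul; [apply: ltn_expl | apply: lt_f].
  have [|F cF FE] := Hf w n rw rn; first by move=> v; have := lt_w v; lia.
  exists (fun v e => c v * F v e); first exact: circ_mul.
  by move=> v x lt_x; rewrite FE // packMl.
- move=> f g _ [wf rwf [lt_f Hf]] _ [wg rwg [lt_g Hg]].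
  pose W v := wf v + wg v.
  have rW : rep W by apply: rep_add.
  have fW v e : (forall l, e l < 2 ^ w0 v) -> f v e < 2 ^ W v.
    by move=> lt_e; rewrite (leq_trans (lt_f v e lt_e)) // leq_pexp2l // leq_addr.
  have gW v e : (forall l, e l < 2 ^ w0 v) -> g v e < 2 ^ W v.
    by move=> lt_e; rewrite (leq_trans (lt_g v e lt_e)) // leq_pexp2l // leq_addl.
  exists (fun v => (W v).+1); auto with rep.
  split=> [v e lt_e|w n rw rn lt_w].
    apply: leq_ltn_trans (leq_subr _ _) _.
    by rewrite (ltn_trans (fW v e lt_e)) ?ltn_exp2l.
  have [|F cF FE] := Hf w n rw rn; first by move=> v; have := lt_w v; rewrite /W; lia.
  have [|G cG GE] := Hg w n rw rn; first by move=> v; have := lt_w v; rewrite /W; lia.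
  pose o v := pack (2 ^ w v) (n v) (fun=> 1).
  have ro : rep o.
    apply: rep_pack1; auto with rep => v.
    by rewrite -{1}(expn0 2) ltn_exp2l // (leq_ltn_trans _ (lt_w v)).
  (* The components of [D] are the [d j] below, those of [T] the bits telling whether [g <= f].
     Multiplied by [2 ^ W - 1], such a bit becomes a mask that keeps the low digits of [d j] or
     clears them all. *)
  pose D v e := 2 ^ W v * o v + F v e - G v e.
  pose T v e := land (D v e) (2 ^ W v * o v) %/ 2 ^ W v.
  have cD : circ D by rewrite /D; auto 20 with circ rep.
  have cT : circ T by rewrite /T; auto 20 with circ rep.
  exists (fun v e => land (D v e) ((2 ^ W v - 1) * T v e)).
    by auto 20 with circ rep.
  move=> v x lt_x; set E := fun l => _.
  pose d j := 2 ^ W v + f v (x j) - g v (x j).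
  have W0 : 0 < 2 ^ W v by rewrite expn_gt0.
  have WWw : 2 ^ (W v).+1 <= 2 ^ w v by rewrite leq_pexp2l // ltnW.
  have lt_d j : j < n v -> d j < 2 ^ (W v).+1.
    by move=> lt_j; rewrite /d expnS; have := fW v _ (lt_x j ^~ lt_j); lia.
  have DE : D v E = pack (2 ^ w v) (n v) d.
    rewrite /D FE // GE // packB => [|j lt_j].
      by rewrite packD -packMl; under [in LHS]eq_pack do rewrite muln1.
    by rewrite (leq_trans (ltnW (gW v _ (lt_x j ^~ lt_j)))) ?leq_addr.
  have oE a : a * o v = pack (2 ^ w v) (n v) (fun=> a).
    by rewrite -packMl; apply: eq_pack => j _; rewrite muln1.
  have TE : T v E = pack (2 ^ w v) (n v) (fun j => 2 ^ W v <= d j).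
    rewrite /T DE oE land_pack => [|j lt_j|j lt_j].
    - rewrite -[RHS](mulnK _ W0) -packMr; congr (_ %/ _); apply: eq_pack => j lt_j.
      by rewrite land_top ?lt_d.
    - exact: leq_trans (lt_d j lt_j) WWw.
    - by rewrite (leq_trans _ WWw) // ltn_exp2l.
  rewrite DE TE -packMl land_pack => [|j lt_j|j lt_j].
  - apply: eq_pack => j lt_j; rewrite mulnC land_sub //.
      exact: fW v _ (lt_x j ^~ lt_j).
    exact: gW v _ (lt_x j ^~ lt_j).
  - exact: leq_trans (lt_d j lt_j) WWw.
  - by move: WWw; rewrite expnS; case: (_ <= d j); lia.
- move=> f g _ [wf rwf [lt_f Hf]] _ [wg rwg [lt_g Hg]].
  exists (fun v => wf v + wg v); auto with rep; split=> [v e lt_e|w n rw rn lt_w].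
    apply: leq_ltn_trans (leq_land _ _) _.
    by rewrite (leq_trans (lt_f v e lt_e)) // leq_pexp2l // leq_addr.
  have lf v : wf v < w v by have := lt_w v; lia.
  have lg v : wg v < w v by have := lt_w v; lia.
  have [F cF FE] := Hf w n rw rn lf.
  have [G cG GE] := Hg w n rw rn lg.
  exists (fun v e => land (F v e) (G v e)); first exact: circ_land.
  move=> v x lt_x; rewrite FE // GE // land_pack // => j lt_j.
    by rewrite (ltn_trans (lt_f v _ (lt_x j ^~ lt_j))) ?ltn_exp2l.
  by rewrite (ltn_trans (lt_g v _ (lt_x j ^~ lt_j))) ?ltn_exp2l.
- move=> s f rs _ [wf rwf [lt_f Hf]]; exists wf => //; split=> [v e lt_e|w n rw rn lt_w].
    by apply: leq_ltn_trans (leq_div _ _) (lt_f v e lt_e).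
  have [F cF FE] := Hf w n rw rn lt_w.
  (* A plain division would move the low bits of each component into its lower neighbour; this mask
     clears them beforehand. *)
  pose o v := (2 ^ w v - 2 ^ s v) * pack (2 ^ w v) (n v) (fun=> 1).
  have ro : rep o.
    apply: rep_mul; auto with rep; apply: rep_pack1; auto with rep => v.
    by rewrite -{1}(expn0 2) ltn_exp2l // (leq_ltn_trans _ (lt_w v)).
  exists (fun v e => land (F v e) (o v) %/ 2 ^ s v); first by auto with circ.
  move=> v x lt_x; have s0 : 0 < 2 ^ s v by rewrite expn_gt0.
  have lt_w2 j : j < n v -> f v (x j) < 2 ^ w v.
    by move=> lt_j; rewrite (ltn_trans (lt_f v _ (lt_x j ^~ lt_j))) ?ltn_exp2l.
  rewrite FE // /o -packMl land_pack => [|j lt_j|j lt_j].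
  - rewrite -[RHS](mulnK _ s0) -packMr; congr (_ %/ _); apply: eq_pack => j lt_j.
    by rewrite muln1 land_high ?lt_w2.
  - exact: lt_w2.
  - by have : 0 < 2 ^ w v; rewrite ?expn_gt0 //; lia.
Qed.

(** * Bounded search and runs of transition systems *)

(** With [j] the least index of a 1, the packed number is [q ^ j * (1 + q * r)], and [1 + q * r] is
    coprime to [q]. *)
Lemma gcdn_pack q n t : 0 < q -> (forall i, t i <= 1) ->
  (exists2 j, j < n & t j = 1) ->
  exists j, [/\ j < n, t j = 1 & gcdn (pack q n t) (q ^ n) = q ^ j].
Proof.
move=> q0; elim: n t => [|n IH] t t1 [j lt_j tj] //; rewrite packS.
case: (posnP (t 0)) => [t0|t0]; last first.
  have e0 : t 0 = 1 by have := t1 0; lia.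
  exists 0; split=> //; rewrite e0 expn0; apply/eqP; rewrite -[_ == _]/(coprime _ _).
  by rewrite coprimeXr // addnC mulnC /coprime gcdnC gcdnMDl gcdn1.
case: j lt_j tj => [|j] lt_j tj; first by rewrite t0 in tj.
have [||k [lt_k tk e]] := IH (fun i => t i.+1); first by move=> i; apply: t1.
  by exists j.
by exists k.+1; split=> //; rewrite t0 add0n !expnS -muln_gcdr e.
Qed.

(* The greatest common divisor of the packed vector of the truth values of
   [f v z = 0] with a large power of the base is the power at the least zero. *)
Lemma rep_search m (f : m.-tuple nat -> (nat -> nat) -> nat) (Z : m.-tuple nat -> nat) :
  circ f -> rep Z ->
  exists2 s, rep s & forall v,
    ((exists2 z, z < Z v & f v (fun=> z) = 0) -> s v < Z v /\ f v (fun=> s v) = 0) /\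
    ((forall z, z < Z v -> f v (fun=> z) <> 0) -> s v = 0).
Proof.
move=> cf rZ; have cg : circ (fun v e => 1 - f v e).
  by apply: circ_sub => //; apply/circ_const/rep_const.
have [w1 rw1 [_ H]] := lift_circ cg rZ.
pose w v := (w1 v + Z v).+1; pose q v := 2 ^ w v.
have rw : rep w by rewrite /w; auto with rep.
have rq : rep q by rewrite /q; auto with rep.
have [|F cF FE] := H w Z rw rZ; first by move=> v; rewrite ltnS leq_addr.
have q1 v : 1 < q v by rewrite -{1}(expn0 2) ltn_exp2l.
pose A v := pack (q v) (Z v) id.
have rA : rep A by apply: rep_packid.
pose P v := F v (fun=> A v).
have rP : rep P by apply: (@rep_circ _ F (fun=> A)).
pose L v := gcdn (P v) (q v ^ Z v).
have rL : rep L.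
  by apply: rep_gcd; auto with rep => v; rewrite expn_gt0 ltnW.
(* Digit [j] of [A] is [j] itself, so dividing by [L = q ^ j] recovers [j] without a logarithm. If
   there is no zero, then [L = q ^ Z] exceeds [A] and the result is 0. *)
exists (fun v => A v %/ L v %% q v); first by auto with rep.
move=> v; have lt_Z j : j < Z v -> j < q v.
  move=> lt_j; apply: (leq_trans (ltn_expl j (isT : 1 < 2))).
  by rewrite leq_pexp2l // /w; lia.
have PE : P v = pack (q v) (Z v) (fun j => 1 - f v (fun=> j)).
  rewrite -(FE v (fun j _ => j)) // => j _ lt_j.
  by apply: (leq_trans (ltn_expl j (isT : 1 < 2))); rewrite leq_pexp2l // ltnW.
split=> [[z lt_z fz]|none].
  have [|||j [lt_j tj]] := @gcdn_pack (q v) (Z v) (fun j => 1 - f v (fun=> j)).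
  - exact: ltnW.
  - by move=> i; apply: leq_subr.
  - by exists z; rewrite ?fz.
  rewrite -PE -/(L v) => ->; rewrite /A pack_digit //; split=> //.
  by move: tj; case: (f v _).
have P0 : P v = 0.
  rewrite PE /pack big1 // => i _; have := none i (ltn_ord i).
  by case: (f v _) => // k _; rewrite subSS.
rewrite /L P0 gcd0n divn_small ?mod0n // pack_lt //.
Qed.

(** One environment for two consecutive states, the variable [l] of the later one being number
    [K + l]; a step condition is then an ordinary [circ] function. *)
Definition pairenv (K : nat) (a b : nat -> nat) (l : nat) : nat :=
  if l < K then a l else if l < K + K then b (l - K) else 0.

Definition run (K : nat) (bound T : nat) (ini : nat -> nat)
    (step fin : (nat -> nat) -> nat) (x : nat -> nat -> nat) : Prop :=
  [/\ forall i l, i <= T -> l < K -> x i l < bound,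
      forall l, l < K -> x 0 l = ini l,
      forall i, i < T -> step (pairenv K (x i) (x i.+1)) = 0
    & fin (pairenv K (x T) (x T)) = 0].

Lemma circ_env m (f : m.-tuple nat -> (nat -> nat) -> nat) v e e' :
  circ f -> (forall l, e l = e' l) -> f v e = f v e'.
Proof.
move=> cf ee'; elim: cf => {f} //=.
- by move=> f g fg _ E; rewrite -!fg.
- by move=> f g _ -> _ ->.
- by move=> c f _ _ ->.
- by move=> f g _ -> _ ->.
- by move=> f g _ -> _ ->.
- by move=> s f _ _ ->.
Qed.

Definition dist (a b : nat) : nat := (a - b) + (b - a).

Lemma dist_eq0 a b : dist a b = 0 <-> a = b.
Proof. by rewrite /dist; split; lia. Qed.

Lemma circ_dist m (f g : m.-tuple nat -> (nat -> nat) -> nat) :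
  circ f -> circ g -> circ (fun v e => dist (f v e) (g v e)).
Proof. by move=> cf cg; apply: circ_add; apply: circ_sub. Qed.

Lemma pack_eq0 q n c : 0 < q -> pack q n c = 0 <-> forall i, i < n -> c i = 0.
Proof.
move=> q0; split=> [/eqP|c0]; last by rewrite /pack big1 // => i _; rewrite c0.
rewrite sum_nat_eq0 => /forallP H i lt_i; have := H (Ordinal lt_i).
by rewrite muln_eq0 expn_eq0 (gtn_eqF q0) /= orbF => /eqP.
Qed.

Lemma circ_pairenv m K (a b : nat -> m.-tuple nat -> (nat -> nat) -> nat) l :
  (forall l, circ (a l)) -> (forall l, circ (b l)) ->
  circ (fun v e => pairenv K (a^~ v^~ e) (b^~ v^~ e) l).
Proof.
move=> ca cb; rewrite /pairenv; case: (l < K); first exact: ca.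
case: (l < K + K); first exact: cb.
by apply/circ_const/rep_const.
Qed.

Lemma run_ext K B T ini step fin (x y : nat -> nat -> nat) :
  (forall e e', (forall l, e l = e' l) -> step e = step e') ->
  (forall e e', (forall l, e l = e' l) -> fin e = fin e') ->
  (forall i l, i <= T -> l < K -> x i l = y i l) ->
  run K B T ini step fin x -> run K B T ini step fin y.
Proof.
move=> es ef xy [xB x0 xs xf]; split.
- by move=> i l le_i lt_l; rewrite -xy ?xB.
- by move=> l lt_l; rewrite -xy // x0.
- move=> i lt_i; rewrite -(xs i lt_i); apply: es => l; rewrite /pairenv.
  by case: ltnP => lt_l; [rewrite xy // ltnW | case: ltnP => // ?; rewrite xy //; lia].
- rewrite -xf; apply: ef => l; rewrite /pairenv.
  by case: ltnP => lt_l; [rewrite xy | case: ltnP => // ?; rewrite xy //; lia].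
Qed.

(* The whole run is guessed as one number [z], whose base-[2 ^ (w * T.+1)]
   digits are the histories of the variables, each packed in base [2 ^ w]. *)
Lemma rep_run m (K out : nat) (bound T : m.-tuple nat -> nat)
    (ini : nat -> m.-tuple nat -> nat) (step fin : m.-tuple nat -> (nat -> nat) -> nat) :
  out < K -> rep bound -> rep T -> (forall l, rep (ini l)) ->
  circ step -> circ fin ->
  let R v := run K (2 ^ bound v) (T v) (ini^~ v) (step v) (fin v) in
  exists2 s, rep s & forall v,
    ((exists x, R v x) -> exists2 x, R v x & s v = x (T v) out) /\
    ((forall x, ~ R v x) -> s v = 0).
Proof.
move=> lt_out rb rT rini cs cf R.
have [w1 rw1 [_ H]] := lift_circ cs rb.
pose w v := (w1 v + bound v).+1; pose q v := 2 ^ w v.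
have rw : rep w by rewrite /w; auto with rep.
have rq : rep q by rewrite /q; auto with rep.
have [|F cF FE] := H w T rw rT; first by move=> v; rewrite ltnS leq_addr.
have q1 v : 1 < q v by rewrite -{1}(expn0 2) ltn_exp2l.
pose M v := w v * (T v).+1.
have rM : rep M by rewrite /M; auto with rep.
pose h l v (e : nat -> nat) := land (e 0 %/ 2 ^ (M v * l)) (2 ^ M v - 1).
have ch l : circ (h l) by rewrite /h; auto 20 with circ rep.
(* Of the history [h l], [lo] omits the last time and [hi] the first, so that [F] applied to both
   treats all [T] consecutive pairs at once. *)
pose lo l v e := land (h l v e) (2 ^ (w v * T v) - 1).
have clo l : circ (lo l) by rewrite /lo; auto 20 with circ rep.
pose hi l v e := h l v e %/ 2 ^ w v.
have chi l : circ (hi l) by rewrite /hi; auto 20 with circ rep.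
pose top l v e := h l v e %/ 2 ^ (w v * T v).
have ctop l : circ (top l) by rewrite /top; auto 20 with circ rep.
pose bot l v e := land (h l v e) (2 ^ w v - 1).
have cbot l : circ (bot l) by rewrite /bot; auto 20 with circ rep.
(* The digits of an arbitrary guess are only known to be below [2 ^ w], but lifting is valid for
   values below [2 ^ bound]. A history equals its conjunction with [msk] exactly when all its values
   are that small. *)
pose msk v := (2 ^ bound v - 1) * pack (q v) (T v).+1 (fun=> 1).
have rmsk : rep msk.
  by apply: rep_mul; auto with rep; apply: rep_pack1; auto with rep.
pose chk v e := \sum_(l < K) dist (h l v e) (land (h l v e) (msk v)) +
  (\sum_(l < K) dist (bot l v e) (ini l v) +
  (F v (pairenv K (lo^~ v^~ e) (hi^~ v^~ e)) +
   fin v (pairenv K (top^~ v^~ e) (top^~ v^~ e)))).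
have cchk : circ chk.
  apply: circ_add; first by apply: circ_sum => l; apply: circ_dist; auto with circ.
  apply: circ_add; first by apply: circ_sum => l; apply: circ_dist; auto with circ.
  by apply: circ_add; apply: circ_comp => // l; apply: circ_pairenv.
pose Z v := 2 ^ (M v * K).
have rZ : rep Z by rewrite /Z; auto with rep.
have [s rs sP] := rep_search cchk rZ.
pose x v z i l := h l v (fun=> z) %/ q v ^ i %% q v.
exists (fun v => x v (s v) (T v) out).
  have rh : rep (fun v => h out v (fun=> s v)) by apply: (@rep_circ _ (h out) (fun=> s)).
  by rewrite /x; auto with rep.
move=> v.
have qT : q v ^ (T v).+1 = 2 ^ M v by rewrite /q -expnM.
have lt_h l z : h l v (fun=> z) < q v ^ (T v).+1.
  by rewrite qT /h land_low ltn_pmod ?expn_gt0.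
have hE l z : h l v (fun=> z) = pack (q v) (T v).+1 ((x v z)^~ l).
  by rewrite [RHS]pack_digits.
have lt_x z i l : x v z i l < q v by rewrite ltn_pmod // ltnW.
have loE l z : lo l v (fun=> z) = pack (q v) (T v) ((x v z)^~ l).
  rewrite /lo land_low expnM -/(q v) hE packSr addnC modnMDl modn_small //.
  by apply: pack_lt.
have botE l z : bot l v (fun=> z) = x v z 0 l.
  by rewrite /bot land_low -/(q v) /x divn1.
have hiE l z : hi l v (fun=> z) = pack (q v) (T v) (fun i => x v z i.+1 l).
  rewrite /hi -/(q v) hE packS addnC mulnC divnMDl ?[_ %/ q v]divn_small ?addn0 //.
  exact: ltnW.
have topE l z : top l v (fun=> z) = x v z (T v) l.
  rewrite /top expnM -/(q v) hE packSr addnC divnMDl ?expn_gt0 1?ltnW //.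
  by rewrite divn_small ?addn0 // pack_lt.
have bq : 2 ^ bound v <= q v by rewrite leq_pexp2l // /w; lia.
have mskP l z : h l v (fun=> z) = land (h l v (fun=> z)) (msk v) <->
    forall i, i <= T v -> x v z i l < 2 ^ bound v.
  have b0 : 0 < 2 ^ bound v by rewrite expn_gt0.
  have -> : land (h l v (fun=> z)) (msk v) =
      pack (q v) (T v).+1 (fun i => x v z i l %% 2 ^ bound v).
    rewrite {1}hE /msk -packMl land_pack => [|i _|i _]; first last.
    - by rewrite muln1 -/(q v); lia.
    - exact: lt_x.
    - by apply: eq_pack => i _; rewrite muln1 land_low.
  split=> [E i le_i|lt]; last first.
    by rewrite {1}hE; apply: eq_pack => i lt_i; rewrite modn_small ?lt.
  rewrite /x E pack_digit ?ltn_pmod // => j _.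
  by apply: leq_trans bq; rewrite ltn_pmod.
have sum0 (f : nat -> nat) : \sum_(l < K) f l = 0 <-> forall l, l < K -> f l = 0.
  split=> [/eqP|f0]; last by rewrite big1 // => l _; rewrite f0.
  by rewrite sum_nat_eq0 => /forallP f0 l lt_l; have /eqP := f0 (Ordinal lt_l).
have stepE z : (forall i l, i <= T v -> l < K -> x v z i l < 2 ^ bound v) ->
    F v (pairenv K (lo^~ v^~ (fun=> z)) (hi^~ v^~ (fun=> z))) =
    pack (q v) (T v) (fun i => step v (pairenv K (x v z i) (x v z i.+1))).
  move=> lt; rewrite -(FE v (fun i => pairenv K (x v z i) (x v z i.+1))).
    apply: (circ_env v cF) => l; rewrite /pairenv; case: (l < K); first exact: loE.
    by case: (l < K + K); [apply: hiE | rewrite /pack big1].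
  move=> j l lt_j; rewrite /pairenv.
  case: (ltnP l K) => lt_l; first by rewrite lt // ltnW.
  by case: (ltnP l) => ?; [rewrite lt //; lia | rewrite expn_gt0].
have finE z : fin v (pairenv K (top^~ v^~ (fun=> z)) (top^~ v^~ (fun=> z))) =
    fin v (pairenv K (x v z (T v)) (x v z (T v))).
  by apply: (circ_env v cf) => l; rewrite /pairenv !topE.
have chkP z : chk v (fun=> z) = 0 <-> R v (x v z).
  pose d1 l := dist (h l v (fun=> z)) (land (h l v (fun=> z)) (msk v)).
  pose st i := step v (pairenv K (x v z i) (x v z i.+1)).
  pose d2 l := dist (bot l v (fun=> z)) (ini l v).
  rewrite /chk finE; split=> [|[lt ini0 st0 ->]].
    move=> /eqP; rewrite !addn_eq0 => /and4P[/eqP c1 /eqP c2 /eqP c3 /eqP c4].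
    have {}c1 := (sum0 d1).1 c1; have {}c2 := (sum0 d2).1 c2.
    have lt i l : i <= T v -> l < K -> x v z i l < 2 ^ bound v.
      by move=> le_i lt_l; apply: (mskP l z).1 le_i; apply/dist_eq0/c1.
    rewrite stepE // in c3; split=> // [l lt_l|]; last first.
      exact: (@pack_eq0 _ _ st (ltnW (q1 v))).1 c3.
    by rewrite -botE; apply/dist_eq0/c2.
  rewrite stepE // addn0 (_ : pack _ _ _ = 0); last first.
    exact: (@pack_eq0 _ _ st (ltnW (q1 v))).2 st0.
  rewrite addn0 (sum0 d1).2 => [|l lt_l]; last first.
    by apply/dist_eq0/mskP => i le_i; apply: lt.
  by apply: (sum0 d2).2 => l lt_l; apply/dist_eq0; rewrite botE ini0.
have [s1 s0] := sP v; split=> [[y Ry]|none].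
  pose z := pack (2 ^ M v) K (fun l => pack (q v) (T v).+1 (y^~ l)).
  have lt_y i l : i <= T v -> l < K -> y i l < q v.
    by case: Ry => lt _ _ _ *; apply: leq_trans bq; apply: lt.
  have lt_p l : l < K -> pack (q v) (T v).+1 (y^~ l) < 2 ^ M v.
    by move=> lt_l; rewrite -qT pack_lt // => i lt_i; apply: lt_y.
  have yx i l : i <= T v -> l < K -> y i l = x v z i l.
    move=> le_i lt_l; rewrite /x /h land_low expnM.
    by rewrite pack_digit // pack_digit // => j lt_j; apply: lt_y.
  have Rx : R v (x v z).
    by apply: run_ext Ry => // e e' ee'; apply: circ_env.
  have [|lt_s /chkP Rs] := s1; last by exists (x v (s v)).
  by exists z; [rewrite /Z expnM pack_lt | apply/chkP].
have -> : s v = 0.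
  by apply: s0 => z _ /chkP /none.
by rewrite /x /h div0n land0x div0n mod0n.
Qed.

(** * Turing machines as affine transition systems *)

Definition affine : Type := nat * seq (nat * nat).

Definition aval (e : nat -> nat) (a : affine) : nat :=
  a.1 + \sum_(t <- a.2) t.1 * e t.2.

Definition move_ok (e : nat -> nat) (mv : seq (affine * affine)) : bool :=
  all (fun p => aval e p.1 == aval e p.2) mv.

(** Truncated subtraction from 1 acts as negation: a move contributes 1 when all its equations hold
    and 0 otherwise, and the whole vanishes when some move contributes. *)
Definition moves_viol (ms : seq (seq (affine * affine))) (e : nat -> nat) : nat :=
  1 - \sum_(mv <- ms) (1 - \sum_(p <- mv) dist (aval e p.1) (aval e p.2)).

Lemma circ_cst m c : @circ m (fun _ _ => c).
Proof. by apply/circ_const/rep_const. Qed.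

Lemma circ_aval m a : @circ m (fun _ e => aval e a).
Proof.
apply: circ_add; first exact: circ_cst.
apply: circ_sum => t; apply: (@circ_mul _ (fun=> t.1)); first exact: rep_const.
exact: circ_var.
Qed.

Lemma circ_moves_viol m ms : @circ m (fun _ e => moves_viol ms e).
Proof.
apply: circ_sub; first exact: circ_cst.
apply: circ_sum => mv; apply: circ_sub; first exact: circ_cst.
by apply: circ_sum => p; apply: circ_dist; apply: circ_aval.
Qed.

Lemma sum_seq_eq0 (I : Type) (r : seq I) (f : I -> nat) :
  (\sum_(i <- r) f i == 0) = all (fun i => f i == 0) r.
Proof. by elim: r => [|i r IH]; rewrite ?big_nil // big_cons addn_eq0 IH. Qed.

Lemma moves_violP ms e : moves_viol ms e = 0 <-> has (move_ok e) ms.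
Proof.
have okE mv : move_ok e mv = (1 - \sum_(p <- mv) dist (aval e p.1) (aval e p.2) != 0).
  rewrite subn_eq0 -ltnNge ltnS leqn0 sum_seq_eq0; apply: eq_all => p.
  by rewrite /dist; lia.
rewrite /moves_viol (eq_has okE) (has_predC (fun mv => _ == 0)) -sum_seq_eq0.
by split=> [|?]; lia.
Qed.

(** * Tapes and words as numbers *)

Definition sym_code (G : finType) (a : option G) : nat :=
  if a is Some g then (enum_rank g).+1 else 0.

Lemma sym_code_lt (G : finType) (a : option G) : sym_code a < #|G|.+1.
Proof. by case: a => [g|] //=; rewrite ltnS ltn_ord. Qed.

Lemma sym_code_inj (G : finType) : injective (@sym_code G).
Proof. by move=> [g|] [g'|] //= [] /ord_inj/enum_rank_inj ->. Qed.

(** The blank has code 0, so trailing blanks leave the number unchanged, just as unlisted cells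
    count as blank; [tape_codeE] therefore covers the empty list too. *)
Definition tape_code (G : finType) (r : seq (option G)) : nat :=
  foldr (fun a x => sym_code a + #|G|.+1 * x) 0 r.

Lemma tape_codeE (G : finType) (r : seq (option G)) :
  tape_code r = sym_code (head None r) + #|G|.+1 * tape_code (behead r).
Proof. by case: r => //=; rewrite muln0. Qed.

Lemma tape_code_behead (G : finType) (r : seq (option G)) :
  tape_code (behead r) = tape_code r %/ #|G|.+1.
Proof.
by rewrite [in RHS]tape_codeE addnC mulnC divnMDl // divn_small ?sym_code_lt ?addn0.
Qed.

(** Uniqueness of division with remainder: an affine equation with guessed symbol and guessed
    quotient already determines the scanned cell and the rest of the tape. *)
Lemma tape_code_head (G : finType) (r : seq (option G)) a x :
  tape_code r = sym_code a + #|G|.+1 * x ->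
  head None r = a /\ tape_code (behead r) = x.
Proof.
move=> E; split; last first.
  by rewrite tape_code_behead E addnC mulnC divnMDl // divn_small ?sym_code_lt ?addn0.
apply: sym_code_inj; have : tape_code r %% #|G|.+1 = sym_code a.
  by rewrite E addnC mulnC modnMDl modn_small ?sym_code_lt.
by rewrite tape_codeE addnC mulnC modnMDl modn_small ?sym_code_lt.
Qed.

Lemma word_code_cons (A : finType) (a : A) w :
  word_code (a :: w) = (enum_rank a).+1 * #|A|.+1 ^ size w + word_code w.
Proof.
have gen (w' : seq A) c : foldl (fun c x => c * #|A|.+1 + (enum_rank x).+1) c w' =
    c * #|A|.+1 ^ size w' + word_code w'.
  rewrite /word_code; elim/last_ind: w' => [|w' x IH]; first by rewrite /= muln1 addn0.
  by rewrite -!cats1 !foldl_cat /= IH size_cat addn1 expnSr mulnDl mulnA addnA.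
by rewrite {1}/word_code /= gen.
Qed.

Lemma leq_size_word_code (A : finType) (w : seq A) : size w <= word_code w.
Proof.
elim: w => //= a w IH; rewrite word_code_cons.
have : 0 < #|A|.+1 ^ size w by rewrite expn_gt0.
by nia.
Qed.

Lemma word_code_inj (A : finType) : injective (@word_code A).
Proof.
move=> w; elim/last_ind: w => [|w a IH] w'; elim/last_ind: w' => [|w' a' _] //;
  rewrite /word_code -!cats1 ?foldl_cat /= -!/(word_code _) //; try lia.
move=> E; have [ea ew] : enum_rank a = enum_rank a' /\ word_code w = word_code w'.
  split; last first.
    have := congr1 (divn^~ #|A|.+1) E; rewrite !divnMDl //.
    by rewrite !divn_small ?ltnS ?ltn_ord // !addn0.
  apply: ord_inj; have := congr1 (modn^~ #|A|.+1) E; rewrite !modnMDl.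
  by rewrite !modn_small ?ltnS ?ltn_ord // => -[].
by rewrite (IH _ ew) (enum_rank_inj ea).
Qed.

(** * The transition system that writes an input and runs the machine *)

Section Machine.
Variables (A : finType) (M : tm (option A)).

Local Notation sym := (option (option A + tm_aux M)).
Local Notation b := #|A|.+1.
Local Notation S := #|{: option A + tm_aux M}|.+1.

Definition letter_sym (x : option A) : sym := Some (inl x).

(** The values 0 and 1 are reserved for the two writing phases. *)
Definition state_code (q : tm_state M) : nat := (enum_rank q).+2.

Definition conf (u w : seq A) (t : nat) : tm_config M :=
  iter t (@tm_step _ M) (tm_init M (pair_word u w)).

(** The input is written from right to left: each letter is pushed at the head, which ends on the
    first cell, where the machine starts. Hence the proof comes before the statement, and each new
    letter is the most significant digit of its code, which calls for a running weight. *)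
Inductive stage : Type :=
| WriteProof of seq A
| WriteStatement of seq A & seq A
| Compute of seq A & seq A & nat.

Inductive next : stage -> stage -> Prop :=
| NextProof a w : next (WriteProof w) (WriteProof (a :: w))
| NextSep w : next (WriteProof w) (WriteStatement [::] w)
| NextStatement a u w : next (WriteStatement u w) (WriteStatement (a :: u) w)
| NextStart u w : next (WriteStatement u w) (Compute u w 0)
| NextCompute u w t : next (Compute u w t) (Compute u w t.+1).

(* The variables are: phase or machine state, weight of the next digit, code of
   the proof, code of the statement, length of the proof, left tape, right tape,
   right tape without its first cell. *)
Definition fields (ph wt p c len : nat) (l r : seq sym) : seq nat :=
  [:: ph; wt; p; c; len; tape_code l; tape_code r; tape_code (behead r)].

Definition stage_fields (s : stage) : seq nat :=
  match s with
  | WriteProof w => fields 0 (b ^ size w) (word_code w) 0 (size w) [::]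
      [seq letter_sym x | x <- map Some w]
  | WriteStatement u w => fields 1 (b ^ size u) (word_code w) (word_code u) (size w)
      [::] [seq letter_sym x | x <- pair_word u w]
  | Compute u w t => fields (state_code (conf u w t).1.1) 0 (word_code w) (word_code u)
      (size w) (conf u w t).1.2 (conf u w t).2
  end.

Definition stage_val (s : stage) (l : nat) : nat := nth 0 (stage_fields s) l.

Local Notation nx l := (8 + l).

Definition const (c : nat) : affine := (c, [::]).
Definition lin (c a l : nat) : affine := (c, [:: (a, l)]).
Definition keep (ls : seq nat) : seq (affine * affine) :=
  [seq (lin 0 1 (nx l), lin 0 1 l) | l <- ls].

Definition write_proof_move (a : A) : seq (affine * affine) :=
  [:: (lin 0 1 0, const 0); (lin 0 1 (nx 0), const 0); (lin 0 1 (nx 1), lin 0 b 1);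
      (lin 0 1 (nx 2), (0, [:: (1, 2); ((enum_rank a).+1, 1)]));
      (lin 0 1 (nx 4), lin 1 1 4);
      (lin 0 1 (nx 6), lin (sym_code (letter_sym (Some a))) S 6)] ++ keep [:: 3; 5].

Definition sep_move : seq (affine * affine) :=
  [:: (lin 0 1 0, const 0); (lin 0 1 (nx 0), const 1); (lin 0 1 (nx 1), const 1);
      (lin 0 1 (nx 6), lin (sym_code (letter_sym None)) S 6)] ++ keep [:: 2; 3; 4; 5].

Definition write_statement_move (a : A) : seq (affine * affine) :=
  [:: (lin 0 1 0, const 1); (lin 0 1 (nx 0), const 1); (lin 0 1 (nx 1), lin 0 b 1);
      (lin 0 1 (nx 3), (0, [:: (1, 3); ((enum_rank a).+1, 1)]));
      (lin 0 1 (nx 6), lin (sym_code (letter_sym (Some a))) S 6)] ++ keep [:: 2; 4; 5].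

Definition start_move : seq (affine * affine) :=
  [:: (lin 0 1 0, const 1); (lin 0 1 (nx 0), const (state_code (tm_start M)));
      (lin 0 1 (nx 1), const 0)] ++ keep [:: 2; 3; 4; 5; 6].

(** The triple guesses the state, the scanned symbol and the symbol to the left of the head; the
    last serves a left move, where the left tape is popped into its own next value. Halted
    configurations repeat, so a run can be padded to a prescribed length. *)
Definition compute_move (x : tm_state M * sym * sym) : seq (affine * affine) :=
  let: (q, a, c) := x in
  (lin 0 1 0, const (state_code q)) :: keep [:: 1; 2; 3; 4] ++
  if tm_halt q is Some _ then keep [:: 0; 5; 6] else
  let: (q', a', m) := tm_delta q a in
  [:: (lin 0 1 (nx 0), const (state_code q')); (lin 0 1 6, lin (sym_code a) S 7)] ++
  match m with
  | MoveLeft => [:: (lin 0 1 5, lin (sym_code c) S (nx 5));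
      (lin 0 1 (nx 6), lin (sym_code c + S * sym_code a') (S * S) 7)]
  | Stay => (lin 0 1 (nx 6), lin (sym_code a') S 7) :: keep [:: 5]
  | MoveRight => [:: (lin 0 1 (nx 5), lin (sym_code a') S 5); (lin 0 1 (nx 6), lin 0 1 7)]
  end.

Definition moves : seq (seq (affine * affine)) :=
  [seq write_proof_move a | a <- enum A] ++ [seq write_statement_move a | a <- enum A]
  ++ [seq compute_move x | x <- enum {: tm_state M * sym * sym}]
  ++ [:: sep_move; start_move].

Lemma aval_const e c : aval e (const c) = c.
Proof. by rewrite /aval big_nil addn0. Qed.

Lemma aval_lin e c a l : aval e (lin c a l) = c + a * e l.
Proof. by rewrite /aval big_seq1. Qed.

Lemma aval_lin2 e c a l a' l' :
  aval e (c, [:: (a, l); (a', l')]) = c + (a * e l + a' * e l').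
Proof. by rewrite /aval big_cons big_seq1. Qed.

Definition avalE := (aval_const, aval_lin, aval_lin2, mul1n, add0n).

Lemma confS u w t : conf u w t.+1 = tm_step (conf u w t).
Proof. by []. Qed.

Lemma next_ok s s' :
  next s s' -> has (move_ok (pairenv 8 (stage_val s) (stage_val s'))) moves.
Proof.
case=> [a w|w|a u w|u w|u w t]; rewrite /moves !has_cat.
- apply/orP; left; rewrite has_map; apply/hasP; exists a; first by rewrite mem_enum.
  rewrite /= /move_ok /= !avalE /= !eqxx /= /pairenv /stage_val /=.
  by rewrite word_code_cons expnS [_ + word_code w]addnC !eqxx.
- do 3!(apply/orP; right); rewrite /= /move_ok /= !avalE /= /pairenv /stage_val /=.
  by rewrite !eqxx ?orbT.
- apply/orP; right; apply/orP; left; rewrite has_map.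
  apply/hasP; exists a; first by rewrite mem_enum.
  rewrite /= /move_ok /= !avalE /= !eqxx /= /pairenv /stage_val /=.
  by rewrite word_code_cons expnS [_ + word_code u]addnC !eqxx.
- do 3!(apply/orP; right); rewrite /= /move_ok /= !avalE /= /pairenv /stage_val /=.
  by rewrite !eqxx ?orbT.
apply/orP; right; apply/orP; right; apply/orP; left; rewrite has_map; apply/hasP.
case E : (conf u w t) => [[q l] r].
exists (q, head None r, head None l); first by rewrite mem_enum.
rewrite /= /move_ok /= !avalE /= /pairenv /stage_val /= E /= !eqxx /=.
case: (tm_halt q) => [ans|]; first by rewrite /= !avalE /= !eqxx.
case: (tm_delta q (head None r)) => [[q' a] []]; rewrite /= !avalE /= !eqxx /=.
- by rewrite -!tape_codeE !eqxx mulnDr mulnA addnA eqxx.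
- by rewrite -tape_codeE !eqxx.
- by rewrite -tape_codeE !eqxx.
Qed.

(** The eighth variable stays free: no move prescribes its next value, and when a step of a machine
    that has not halted reads it, [tape_code_head] forces it to be the code of the tail. *)
Definition agree (y : nat -> nat) (s : stage) : Prop :=
  [:: y 0; y 1; y 2; y 3; y 4; y 5; y 6] = take 7 (stage_fields s).

(** Variable 0 reveals the kind of stage, and the equations of a move fix the next values of the
    seven tracked variables, so a guessed run cannot leave the intended stages. *)
Lemma agree_step s y y' : agree y s ->
  has (move_ok (pairenv 8 y y')) moves -> exists s', agree y' s'.
Proof.
rewrite /moves !has_cat => ys /or4P[] /hasP[mv].
- move=> /mapP[a _ ->]; rewrite /move_ok /= !avalE /= /pairenv /= !addKn.
  case/and5P=> /eqP e0 /eqP f0 /eqP f1 /eqP f2 /and5P[/eqP f4 /eqP f6 /eqP f3 /eqP f5 _].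
  case: s ys => [w|u w|u w t] [y0 y1 y2 y3 y4 y5 y6]; try by rewrite e0 in y0.
  exists (WriteProof (a :: w)); rewrite /agree f0 f1 f2 f3 f4 f5 f6 y1 y2 y3 y4 y5 y6.
  by rewrite /= word_code_cons expnS [_ + word_code w]addnC.
- move=> /mapP[a _ ->]; rewrite /move_ok /= !avalE /= /pairenv /= !addKn.
  case/and5P=> /eqP e0 /eqP f0 /eqP f1 /eqP f3 /and5P[/eqP f6 /eqP f2 /eqP f4 /eqP f5 _].
  case: s ys => [w|u w|u w t] [y0 y1 y2 y3 y4 y5 y6]; try by rewrite e0 in y0.
  exists (WriteStatement (a :: u) w).
  rewrite /agree f0 f1 f2 f3 f4 f5 f6 y1 y2 y3 y4 y5 y6.
  by rewrite /= word_code_cons expnS [_ + word_code u]addnC.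
- move=> /mapP[[[q a] c] _ ->]; rewrite /move_ok /= !avalE /= /pairenv /= !addKn.
  case/and5P=> /eqP e0 /eqP f1 /eqP f2 /eqP f3 /andP[/eqP f4 st].
  case: s ys => [w|u w|u w t] [y0 y1 y2 y3 y4 y5 y6]; try by rewrite e0 in y0.
  exists (Compute u w t.+1); rewrite /agree f1 f2 f3 f4 y1 y2 y3 y4 /stage_fields confS.
  move: y0 y5 y6; rewrite e0; case: (conf u w t) => [[q1 l] r] /=.
  case=> /ord_inj/enum_rank_inj <- y5 y6.
  case E: (tm_halt q) st => [ans|].
    rewrite /= !avalE /= !addKn => /and4P[/eqP f0 /eqP f5 /eqP f6 _].
    by rewrite f0 f5 f6 e0 y5 y6.
  case D: (tm_delta q a) => [[q' a'] mo] /=.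
  rewrite !avalE /= !addKn => /and3P[/eqP f0 /eqP g6].
  rewrite y6 in g6; have [hr tr] := tape_code_head g6; rewrite hr D.
  case: mo {D}; rewrite /= !avalE /= ?addKn => /and3P[/eqP f5 /eqP f6 _].
  + rewrite y5 in f5; have [hl tl] := tape_code_head f5.
    by rewrite f0 hl tl f6 tr mulnDr mulnA addnA.
  + by rewrite f0 f5 f6 tr y5.
  + by rewrite f0 f5 f6 tr y5.
- rewrite !inE => /orP[]/eqP->; rewrite /move_ok /= !avalE /= /pairenv /= !addKn.
    case/and5P=> /eqP e0 /eqP f0 /eqP f1 /eqP f6.
    case/and5P=> /eqP f2 /eqP f3 /eqP f4 /eqP f5 _.
    case: s ys => [w|u w|u w t] [y0 y1 y2 y3 y4 y5 y6]; try by rewrite e0 in y0.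
    exists (WriteStatement [::] w).
    by rewrite /agree f0 f1 f2 f3 f4 f5 f6 y2 y3 y4 y5 y6.
  case/and5P=> /eqP e0 /eqP f0 /eqP f1 /eqP f2 /and5P[/eqP f3 /eqP f4 /eqP f5 /eqP f6 _].
  case: s ys => [w|u w|u w t] [y0 y1 y2 y3 y4 y5 y6]; try by rewrite e0 in y0.
  exists (Compute u w 0).
  by rewrite /agree f0 f1 f2 f3 f4 f5 f6 y2 y3 y4 y5 y6.
Qed.

(** A generous factor by which one step may enlarge the largest variable: [b] for weights and word
    codes, [S * S] for a left move, which puts two symbols on the right tape, and the number of
    states for state codes. Since [growth ^ i <= 2 ^ (growth * i)], it yields a bound of the form
    that [rep_run] expects. *)
Definition growth : nat := b + 3 * (S * S) + #|tm_state M| + 3.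

Lemma fields_le ph wt p c len (l r : seq sym) g :
  [/\ ph <= g, wt <= g, p <= g, c <= g & len <= g] ->
  tape_code l <= g -> tape_code r <= g ->
  forall i, nth 0 (fields ph wt p c len l r) i <= g.
Proof.
move=> [? ? ? ? ?] ? le_r; do 7!case=> //; case=> [|i]; last by rewrite nth_default.
by rewrite /= tape_code_behead (leq_trans (leq_div _ _)).
Qed.

Lemma next_growth s s' g : 0 < g -> next s s' ->
  (forall l, stage_val s l <= g) -> forall l, stage_val s' l <= growth * g.
Proof.
move=> g0 ss' le_s.
have gE : growth * g = b * g + 3 * (S * S * g) + #|tm_state M| * g + 3 * g.
  by rewrite /growth !mulnDl -mulnA.
have [bG [SG [QG g3]]] : b * g <= growth * g /\ 3 * (S * S * g) <= growth * g /\
    #|tm_state M| * g + 3 * g <= growth * g /\ 3 * g <= growth * g.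
  rewrite gE; move: (b * g) (S * S * g) (#|tm_state M| * g) => x1 x2 x3.
  by repeat split; lia.
have S1 : S * 1 <= S * g by rewrite leq_mul2l g0.
have S2 : S * g <= S * S * g by rewrite leq_mul2r leq_pmull ?orbT.
have Sg : S + S * g <= growth * g.
  by move: S1 S2 SG; rewrite muln1; move: (S * g) (S * S * g) (growth * g); lia.
have Sg2 : S + S * (S + S * g) <= growth * g.
  have : S * S * 1 <= S * S * g by rewrite leq_mul2l g0 orbT.
  rewrite mulnDr [S * (S * g)]mulnA; move: S1 S2 SG; rewrite !muln1.
  by move: (S * S * g) (S * S) (S * g) (growth * g); lia.
have bg x : x < b -> g + x * g <= growth * g.
  by move=> lt_x; rewrite -mulSn; apply: leq_trans bG; rewrite leq_mul2r lt_x orbT.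
have gg : g <= growth * g by move: (growth * g) g3; lia.
have g2 : g.+1 <= growth * g by move: (growth * g) g3; lia.
have Qg (q : tm_state M) : state_code q <= growth * g.
  rewrite /state_code; have lt_q : enum_rank q < #|tm_state M| := ltn_ord _.
  have : #|tm_state M| * 1 <= #|tm_state M| * g by rewrite leq_mul2l g0 orbT.
  by move: (#|tm_state M| * g) (growth * g) QG => x1 x2; rewrite muln1; lia.
have le_gg x : x <= g -> x <= growth * g by move=> le_x; apply: leq_trans gg.
have push (a : sym) x : x <= g -> sym_code a + S * x <= growth * g.
  move=> le_x; apply: leq_trans Sg; apply: leq_add; last exact: leq_mul.
  exact/ltnW/sym_code_lt.
have powS n : b ^ n <= g -> b ^ n.+1 <= growth * g.
  by move=> le_n; apply: leq_trans bG; rewrite expnS leq_mul2l le_n orbT.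
have consS (a : A) w : b ^ size w <= g -> word_code w <= g ->
    word_code (a :: w) <= growth * g.
  move=> le_n le_w; have lt_a : (enum_rank a).+1 < b by rewrite ltnS ltn_ord.
  apply: leq_trans (bg _ lt_a); rewrite word_code_cons addnC.
  by rewrite leq_add // leq_mul2l le_n orbT.
case: ss' le_s => [a w|w|a u w|u w|u w t] le_s;
  have := (le_s 1, le_s 2, le_s 3, le_s 4, le_s 5, le_s 6);
  rewrite /stage_val /= => -[[[[[h1 h2] h3] h4] h5] h6];
  apply: fields_le => //=; try exact: le_gg.
- by split=> //; [apply: powS | apply: consS | apply: leq_trans g2].
- exact: (push (Some (inl (Some a)))).
- by split; rewrite ?le_gg // (leq_trans _ g2).
- exact: (push (Some (inl None))).
- by split; rewrite ?powS ?consS ?le_gg // (leq_trans _ g2).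
- exact: (push (Some (inl (Some a)))).
- by split; rewrite ?Qg ?leq0n ?le_gg.
- by split; rewrite ?Qg ?leq0n ?le_gg.
- move: h5 h6; case: (conf u w t) => [[q l] r] /= h5 h6; case: (tm_halt q) => [_|] /=.
    exact: le_gg.
  case: (tm_delta q (head None r)) => [[q' a] []] /=; last exact: push; last exact: le_gg.
  by rewrite tape_code_behead le_gg // (leq_trans (leq_div _ _)).
- have hb r : tape_code r <= g -> tape_code (behead r) <= g.
    by move=> le_r; rewrite tape_code_behead (leq_trans (leq_div _ _)).
  move: h5 h6; case: (conf u w t) => [[q l] r] /= h5 h6; case: (tm_halt q) => [_|] /=.
    exact: le_gg.
  case: (tm_delta q (head None r)) => [[q' a] []] /=.
  + apply: leq_trans Sg2; apply: leq_add; first exact/ltnW/sym_code_lt.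
    apply: leq_mul => //; apply: leq_add; first exact/ltnW/sym_code_lt.
    exact/leq_mul/hb.
  + exact/push/hb.
  + exact/le_gg/hb.
Qed.

Inductive reach : nat -> stage -> Prop :=
| Reach0 : reach 0 (WriteProof [::])
| ReachS n s s' : reach n s -> next s s' -> reach n.+1 s'.

Lemma reach_compute u w t : reach (size w + 1 + size u + 1 + t) (Compute u w t).
Proof.
have rp : reach (size w) (WriteProof w).
  by elim: w => [|a w IH]; [apply: Reach0 | apply: ReachS IH (NextProof a w)].
have rs : reach (size w + 1 + size u) (WriteStatement u w).
  elim: u => [|a u IH].
    by rewrite addn0 addn1; apply: ReachS rp (NextSep w).
  by rewrite /= [_ + (size u).+1]addnS; apply: ReachS IH (NextStatement a u w).
elim: t => [|t IH]; last by rewrite [_ + t.+1]addnS; apply: ReachS IH (NextCompute u w t).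
by rewrite addn0 addn1; apply: ReachS rs (NextStart u w).
Qed.

Lemma reach_path n s : reach n s -> exists2 p : nat -> stage,
  p 0 = WriteProof [::] /\ p n = s &
  (forall i, i < n -> next (p i) (p i.+1)) /\
  forall i l, i <= n -> stage_val (p i) l <= growth ^ i.
Proof.
elim=> {n s} [|n s s' _ [p [p0 pn] [pS pb]] ss'].
  exists (fun=> WriteProof [::]) => //; split=> // i l; rewrite leqn0 => /eqP ->.
  by rewrite expn0 /stage_val; do 8!case: l => //= l; rewrite nth_nil.
have growth0 : 0 < growth by rewrite /growth addn3.
exists (fun i => if i <= n then p i else s'); first by rewrite leq0n ltnn.
split=> [i|i l].
  rewrite ltnS => le_i; rewrite le_i; case: ltnP => [/pS //|le_n].
  by have -> : i = n; [lia | rewrite pn].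
rewrite leq_eqVlt ltnS => /orP[/eqP ->|le_i]; last by rewrite le_i pb.
rewrite ltnn expnS; apply: next_growth ss' _ l; first by rewrite expn_gt0 growth0.
by move=> l; rewrite -pn pb.
Qed.
End Machine.

(** * Accepting runs: soundness and completeness *)

Section Accept.
Variables (A : finType) (M : tm (option A)).

Lemma halt_stable (u w : seq A) t t' a : tm_halt (conf M u w t).1.1 = Some a ->
  t <= t' -> tm_halt (conf M u w t').1.1 = Some a.
Proof.
move=> ha /subnK <-; elim: (t' - t) => [|i IH] //; rewrite addSn confS.
by move: IH; case E : (conf M u w (i + t)) => [[q l] r] /= h; rewrite h.
Qed.

Definition accept_viol (n k : nat) (e : nat -> nat) : nat :=
  (1 - \sum_(q <- [seq q <- enum (tm_state M) | tm_halt q == Some true])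
         (1 - dist (e 0) (state_code q))) + (dist (e 3) n + (e 4 - k)).

Lemma accept_violP n k e : accept_viol n k e = 0 <->
  [/\ exists2 q, tm_halt q = Some true & e 0 = @state_code A M q, e 3 = n & e 4 <= k].
Proof.
have qP : (\sum_(q <- [seq q <- enum (tm_state M) | tm_halt q == Some true])
    (1 - dist (e 0) (state_code q)) != 0) <->
    exists2 q, tm_halt q = Some true & e 0 = @state_code A M q.
  rewrite sum_seq_eq0 -has_predC; split=> [/hasP[q]|[q hq eq]].
    rewrite mem_filter => /andP[/eqP hq _] /= d; exists q => //.
    by apply/dist_eq0; move: d; lia.
  apply/hasP; exists q; first by rewrite mem_filter hq eqxx mem_enum.
  by rewrite /= eq (_ : dist _ _ = 0) //; apply/dist_eq0.
rewrite /accept_viol; split.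
  move=> /eqP; rewrite addn_eq0 [X in _ && X]addn_eq0.
  case/and3P=> q0 /eqP/dist_eq0 e3 le4.
  by split=> //; apply/qP; rewrite -lt0n; move: q0; lia.
case=> /qP q0 /dist_eq0 -> le4; rewrite (eqP (_ : e 4 - k == 0)) ?subn_eq0 //.
by move: q0; lia.
Qed.

Lemma circ_accept_viol m (n k : m.-tuple nat -> nat) : rep n -> rep k ->
  circ (fun v e => accept_viol (n v) (k v) e).
Proof.
move=> rn rk; apply: circ_add.
  apply: circ_sub; first exact: circ_cst.
  apply: circ_sum => q; apply: circ_sub; first exact: circ_cst.
  by apply: circ_dist; [apply: circ_var | apply: circ_cst].
apply: circ_add; first by apply: circ_dist; [apply: circ_var | apply: circ_const].
by apply: circ_sub; [apply: circ_var | apply: circ_const].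
Qed.

Lemma run_sound B T n k x :
  run 8 B T (stage_val M (WriteProof [::])) (moves_viol (moves M)) (accept_viol n k) x ->
  exists u w t, [/\ tm_halt (conf M u w t).1.1 = Some true, word_code u = n,
    size w <= k & x T 2 = word_code w].
Proof.
case=> _ x0 xs /accept_violP[[q hq xq] xn xk].
have ag i : i <= T -> exists s : stage A, agree M (x i) s.
  elim: i => [|i IH] le_i.
    by exists (WriteProof [::]); rewrite /agree !x0.
  have [s ys] := IH (ltnW le_i); apply: agree_step ys _.
  exact/moves_violP/xs.
have [s] := ag T (leqnn T); move: xq xn xk; rewrite /pairenv /= => xq xn xk.
(* A state code is at least 2, which excludes the writing stages. *)
case: s => [w|u w|u w t] [y0 _ y2 y3 y4 _ _]; try by rewrite xq in y0.
exists u, w, t; split; rewrite -?y3 -?y4 //.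
by move: y0; rewrite xq => -[] /ord_inj/enum_rank_inj <-.
Qed.

Lemma run_complete T u w t : tm_halt (conf M u w t).1.1 = Some true ->
  size w + 1 + size u + 1 + t <= T ->
  exists x, run 8 (2 ^ (growth M * T).+1) T (stage_val M (WriteProof [::]))
    (moves_viol (moves M)) (accept_viol (word_code u) (size w)) x.
Proof.
(* The [d] spare steps repeat the halted configuration. *)
move=> ht /subnK; set d := T - _; rewrite addnC -addnA => Td.
have [p [p0 pT] [pS pb]] := reach_path M (reach_compute u w (t + d)).
rewrite -Td in pT pS pb *.
exists (fun i => stage_val M (p i)); split.
- move=> i l le_i _; apply: (leq_ltn_trans (pb i l le_i)).
  apply: (@leq_ltn_trans (2 ^ (growth M * i))).
    by rewrite expnM; case: (i) => // j; rewrite leq_exp2r // ltnW //; apply: ltn_expl.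
  by rewrite ltn_exp2l // ltnS leq_mul2l le_i orbT.
- by move=> l _; rewrite p0.
- by move=> i lt_i; apply/moves_violP/next_ok/pS.
apply/accept_violP; rewrite pT /pairenv /stage_val /=; split=> //.
by exists (conf M u w (t + d)).1.1; rewrite // (halt_stable ht) // leq_addr.
Qed.
End Accept.

(** * Bounded witnesses for polynomial-time relations *)

Lemma rep_decidable2 (A : finType) (R : seq A -> seq A -> Prop) :
  poly_time_decidable2 R ->
  exists2 s : 2.-tuple nat -> nat, rep s & forall n k : nat,
    ((exists u w, [/\ word_code u = n, size w <= k & R u w]) ->
     exists u w, [/\ word_code u = n, size w <= k, R u w
                   & s [tuple n; k] = word_code w]) /\
    ((forall u w, word_code u = n -> size w <= k -> ~ R u w) -> s [tuple n; k] = 0).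
Proof.
move=> [M [c [d HM]]].
pose n (v : 2.-tuple nat) := tnth v ord0; pose k (v : 2.-tuple nat) := tnth v ord_max.
(* Letters of [w], separator, letters of [u], start, then the time bound of the machine. The length
   of [u] is replaced by its upper bound [n], the code of [u]. *)
pose T v := k v + 1 + n v + 1 + (c * (n v + 1 + k v) ^ d + c).
have rn : rep n by apply: rep_var.
have rk : rep k by apply: rep_var.
have rT : rep T by rewrite /T; auto 50 with rep.
have rB : rep (fun v => (growth M * T v).+1) by auto with rep.
have [s rs sP] := @rep_run 2 8 2 _ T (fun l _ => stage_val M (WriteProof [::]) l)
  (fun _ e => moves_viol (moves M) e) (fun v e => accept_viol M (n v) (k v) e)
  isT rB rT (fun l => rep_const _ _) (circ_moves_viol _ _) (circ_accept_viol M rn rk).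
exists s => // n0 k0; have [s1 s0] := sP [tuple n0; k0].
have nE : n [tuple n0; k0] = n0 by [].
have kE : k [tuple n0; k0] = k0 by [].
have sound u w t : tm_halt (conf M u w t).1.1 = Some true -> R u w.
  move=> ht; have [t' [a [_ ht' aR]]] := HM u w; apply/aR.
  have := halt_stable ht (leq_maxl t t').
  by rewrite (halt_stable ht' (leq_maxr t t')) => -[->].
have run_exists u w : word_code u = n0 -> size w <= k0 -> R u w ->
    exists x, run 8 (2 ^ (growth M * T [tuple n0; k0]).+1) (T [tuple n0; k0])
      (stage_val M (WriteProof [::])) (moves_viol (moves M)) (accept_viol M n0 k0) x.
  move=> un wk Ruw; have [t [a [le_t ht aR]]] := HM u w.
  have {aR} a1 : a = true by apply/aR.
  rewrite {a}a1 in ht.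
  have [|x [xB x0 xs /accept_violP xf]] := @run_complete A M (T [tuple n0; k0]) u w t ht.
    rewrite /T nE kE; have := leq_size_word_code u; rewrite un => le_u.
    have : c * size (pair_word u w) ^ d <= c * (n0 + 1 + k0) ^ d.
      rewrite leq_mul2l; apply/orP; right; case: (d) => // d'; rewrite leq_exp2r //.
      by rewrite size_cat /= !size_map; lia.
    by move: le_t; move: (c * _) (c * _) => x1 x2; lia.
  exists x; split=> //; apply/accept_violP; case: xf => q e3 e4; split=> //.
    by rewrite e3 un.
  exact: leq_trans wk.
split=> [[u [w [un wk Ruw]]]|none].
  have [x Rx ->] := s1 (run_exists u w un wk Ruw).
  have [u' [w' [t [ht un' wk' xE]]]] := run_sound Rx.
  by exists u', w'; split=> //; apply: sound ht.
apply: s0 => x Rx; have [u' [w' [t [ht un' wk' xE]]]] := run_sound Rx.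
by apply: (none u' w') => //; apply: sound ht.
Qed.

(** * Unique readability of statements *)

Lemma cat_sep_inj (A : eqType) (x : A) s s' t t' : x \notin s -> x \notin s' ->
  s ++ x :: t = s' ++ x :: t' -> s = s' /\ t = t'.
Proof.
elim: s s' => [|y s IH] [|y' s'] //=.
- by move=> _ _ [].
- by rewrite inE negb_or => _ /andP[/eqP ne _] [].
- by rewrite inE negb_or => /andP[/eqP ne _] _ [] /esym.
rewrite !inE !negb_or => /andP[_ xs] /andP[_ xs'] [-> e].
by have [-> ->] := IH _ xs xs' e.
Qed.

(** Nonemptiness of the items separates the empty list from the list of one empty word, whose joins
    coincide. *)
Lemma join_inj (A : eqType) (x : A) (ws ws' : seq (seq A)) :
  all (fun w => (w != [::]) && (x \notin w)) ws ->
  all (fun w => (w != [::]) && (x \notin w)) ws' ->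
  join x ws = join x ws' -> ws = ws'.
Proof.
elim: ws ws' => [|w [|w1 ws] IH] [|w' [|w1' ws']] //.
- by case: w' => [|a w'] _ /andP[/andP[]].
- by case: w' => [|a w'] _ /andP[/andP[]].
- by case: w => [|a w] /andP[/andP[]].
- by move=> _ _ /= ->.
- by move=> /andP[/andP[_ xw] _] _ /= e; rewrite e mem_cat mem_head orbT in xw.
- by case: w {IH} => [|a w] /andP[/andP[]].
- by move=> _ /andP[/andP[_ xw] _] /= e; rewrite -e mem_cat mem_head orbT in xw.
move=> /andP[/andP[_ xw] xws] /andP[/andP[_ xw'] xws'] /(cat_sep_inj xw xw')[-> e].
by rewrite (IH (w1' :: ws') xws xws' e).
Qed.

(** The verifier only certifies a proof of some statement with the given code; this identifies that
    statement with the one at hand. The first turnstile marks the end of the axioms, since neither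
    formulas nor semicolons contain it. *)
Lemma statement_word_inj (E : encoding) T T' phi phi' :
  statement_word E T phi = statement_word E T' phi' -> T = T' /\ phi = phi'.
Proof.
have no_turnstile (S : seq formula) :
    turnstile E \notin join (semicolon E) (map (enc_formula E) S).
  elim: S => [|f [|g S] IH] //=; first exact: enc_formula_turnstile.
  rewrite mem_cat negb_or enc_formula_turnstile inE negb_or IH andbT.
  by rewrite eq_sym semicolon_turnstile.
move=> /cat_sep_inj[] // eT /enc_formula_inj ->; split=> //.
have sep (S : seq formula) :
    all (fun w => (w != [::]) && (semicolon E \notin w)) (map (enc_formula E) S).
  by elim: S => //= f S ->; rewrite enc_formula_nonempty enc_formula_semicolon.
exact/(inj_map (@enc_formula_inj E))/(join_inj _ _ eT).
Qed.

Theorem theorem4 (E : encoding) (HE : poly_time_verifiable E) :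
  exists W : aterm 2, forall n k : nat,
    (forall (T : seq formula) (phi : formula),
        is_statement_code E T phi n ->
        (exists p : nat, is_proof_code_le E T phi k p) ->
        is_proof_code_le E T phi k (aeval [tuple n; k] W))
    /\
    (~ (exists (T : seq formula) (phi : formula),
          is_statement_code E T phi n /\
          (exists p : nat, is_proof_code_le E T phi k p)) ->
     aeval [tuple n; k] W = 0).
Proof.
have [s [W WE] sP] := rep_decidable2 HE.
exists W => n k; rewrite WE; have [s1 s0] := sP n k; split.
  move=> T phi [sT nE] [p [P [pP le_k pE]]].
  have [|u [w [un wk [T' [phi' [P' [sT' uE wE pP']]]] ->]]] := s1.
    by exists (statement_word E T phi), (proof_word E P); split=> //; exists T, phi, P.
  have [eT ephi] : T' = T /\ phi' = phi.
    by apply: (@statement_word_inj E); apply: word_code_inj; rewrite -uE un -nE.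
  by exists P'; rewrite -eT -ephi -wE.
move=> none; apply: s0 => u w un wk [T [phi [P [sT uE wE pP]]]].
apply: none; exists T, phi; split; first by rewrite /is_statement_code -uE.
by exists (word_code w), P; rewrite -wE.
Qed.
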